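(* Let $n\ge 1$. The number of maximal elements in the poset $\mathrm{Weak}(F_n)$ is the Catalan number $$C_{n-1}=\frac1n\binom{2n-2}{n-1}.$$
   Context: $S_n$ is the symmetric group on $\{1,\dots,n\}$, with product $(\pi\sigma)(i)=\pi(\sigma(i))$; $(a,b)$ denotes a transposition, and $T$ is the set of all transpositions in $S_n$. Let $c=(1,2,\dots,n)$ be the $n$-cycle. $NC(n)=\{\pi\in S_n:\ \ell_T(\pi)+\ell_T(\pi^{-1}c)=\ell_T(c)\}$, where $\ell_T(\pi)$ is the minimal number of factors in an expression of $\pi$ as a product of transpositions, ordered by $\pi\le\sigma\iff \ell_T(\pi)+\ell_T(\pi^{-1}\sigma)=\ell_T(\sigma)$. $F_n$ is the set of maximal chains of $NC(n)$; it is identified with the set of words $(t_1,\dots,t_{n-1})$ of transpositions with $t_1t_2\cdots t_{n-1}=c$, the word corresponding to the chain $id<t_1<t_1t_2<\cdots<c$ (for $n=1$, $F_1$ consists of the empty word). For $1\le i\le n-2$ and $v=(t_1,\dots,t_{n-1})\in F_n$, $R_i(v)$ is obtained from $v$ by replacing $(t_i,t_{i+1})$ by $(t_{i+1}^{t_i},t_i)$, and $L_i(v)$ by replacing $(t_i,t_{i+1})$ by $(t_{i+1},t_i^{t_{i+1}})$, where $g^h=h^{-1}gh$. The Hurwitz graph $G_T(n)$ is the undirected graph with vertex set $F_n$, two chains being adjacent if they differ in exactly one element; equivalently, $u,v$ are adjacent iff $v=R_i(u)$ or $v=L_i(u)$ for some $i$ (and $u\neq v$). It is connected. Put $e=((1,2),(2,3),\dots,(n-1,n))\in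 F_n$. The poset $\mathrm{Weak}(F_n)$ is $F_n$ with the order: $u\le v$ iff $u$ lies on a geodesic in $G_T(n)$ from $e$ to $v$. *)

(* Defs.v *)
From mathcomp Require Import all_boot all_order all_algebra all_fingroup.
From mathcomp Require Import boolp.

Set Implicit Arguments.
Unset Strict Implicit.
Unset Printing Implicit Defensive.

(* The symmetric group on {1, ..., n} is 'S_n, acting on 'I_n = {0, ..., n-1}.
   MathComp composes permutations from left to right, (s * t) x = t (s x);
   [compp] is the right-to-left product (p s)(i) = p (s i). *)
Definition compp (n : nat) (p s : 'S_n) : 'S_n := (s * p)%g.

Lemma comppE (n : nat) (p s : 'S_n) (i : 'I_n) : compp p s i = p (s i).
Proof. exact: permM. Qed.

Definition prodp (n : nat) (w : seq 'S_n) : 'S_n := foldr (@compp n) 1%g w.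

Definition transpositions (n : nat) : {set 'S_n} :=
  [set tperm x.1 x.2 | x : 'I_n * 'I_n & x.1 != x.2].

Definition has_Tword (n : nat) (p : 'S_n) (k : nat) : bool :=
  [exists w : k.-tuple 'S_n,
     all [in transpositions n] w && (prodp w == p)].

Lemma ex_Tword (n : nat) (p : 'S_n) : exists k, has_Tword p k.
Proof.
have [ts -> dts] := prod_tpermP p.
pose w := rev [seq tperm x.1 x.2 | x <- ts].
exists (size w); apply/existsP; exists (in_tuple w); apply/andP; split => /=.
  rewrite all_rev all_map; apply: sub_all dts => x dx /=.
  by apply/imsetP; exists x; rewrite // inE.
apply/eqP; rewrite /w; elim: ts {dts w} => [|x ts IHts] /=.
  by rewrite big_nil.
rewrite big_cons -IHts rev_cons; move: (rev _) => w; elim: w => [|t w IHw] /=.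
  by rewrite /compp mul1g mulg1.
by rewrite IHw /compp mulgA.
Qed.

Definition ellT (n : nat) (p : 'S_n) : nat := ex_minn (ex_Tword p).

(* c = (1, 2, ..., n), that is, i |-> i + 1 mod n on 'I_n. *)
Definition long_cycle (n : nat) : 'S_n := perm (@ordS_inj n).

Definition leT (n : nat) (p s : 'S_n) : bool :=
  ellT p + ellT (compp p^-1%g s) == ellT s.

Definition NC (n : nat) : {set 'S_n} := [set p | leT p (long_cycle n)].

Definition is_chain (n : nat) (C : {set 'S_n}) : bool :=
  [forall p in C, forall s in C, leT p s || leT s p].

(* F_n: the inclusion-maximal chains of the poset NC(n). *)
Definition max_chains (n : nat) : {set {set 'S_n}} :=
  [set C | maxset [pred D : {set 'S_n} | (D \subset NC n) && is_chain D] C].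

(* The elements id, t_1, t_1 t_2, ..., t_1 ... t_k for w = (t_1, ..., t_k). *)
Definition chain_of_word (n : nat) (w : seq 'S_n) : {set 'S_n} :=
  [set prodp (take k w) | k : 'I_(size w).+1].

(* e = ((1,2), (2,3), ..., (n-1,n)); the filter drops the last point, whose
   cyclic successor is the first one. *)
Definition base_chain (n : nat) : {set 'S_n} :=
  chain_of_word [seq tperm i (ordS i) | i : 'I_n <- enum 'I_n & i.+1 < n].

Definition hurwitz_adj (n : nat) : rel {set 'S_n} := fun u v =>
  [&& u \in max_chains n, v \in max_chains n,
      #|u :\: v| == 1 & #|v :\: u| == 1].

Definition geodesic (V : eqType) (g : rel V) (x y : V) (p : seq V) : Prop :=
  [/\ path g x p, last x p = y
    & forall q, path g x q -> last x q = y -> size p <= size q].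

Definition weak_le (n : nat) (u v : {set 'S_n}) : Prop :=
  exists p, geodesic (@hurwitz_adj n) (base_chain n) v p
            /\ u \in base_chain n :: p.

Definition weak_maximal (n : nat) (v : {set 'S_n}) : Prop :=
  v \in max_chains n /\
  forall w, w \in max_chains n -> weak_le v w -> w = v.

(* Main.v *)
Require Import Defs.
From mathcomp Require Import all_boot all_order all_algebra all_fingroup.
From mathcomp Require Import boolp zify.

(** A cover p < q of NC(n) merges two cycles of p. Call the larger of their two
minima the label of the cover: it is the one cycle minimum of p that q loses.
Along a maximal chain every point except the first is lost exactly once, so the
labels form a permutation of the other n - 1 points.

The proof shows that the distance from e in the Hurwitz graph is the number of
inversions of this permutation. Two adjacent chains differ in one element, hence
in the order of two consecutive labels at most, and the number of inversions
changes by at most one ([inversions_adj]). Conversely every interval of rank two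
contains chains with both orders of its two labels ([exchange]), so any descent
can be removed and any ascent can be turned into a descent by one step of the
graph ([adjacent_swap]). Noncrossingness enters here: if a cycle B of p is
merged with a cycle of smaller minimum, the merge happens at the largest element
of B ([merge_at_max]), so two such merges of B share a point and the third merge
among the three cycles is available. The only chain without descents is e
([base_unique]), which identifies the distance ([path_from_base],
[path_inversions]). Therefore the maximal elements are the chains with
decreasing labels ([weak_maximalP]).

It remains to count these. In a chain with decreasing labels, the element s_m
with m + 1 cycles has cycle minima 0, ..., m. Going down from s_m to s_(m+1), a
cycle with minimum m + 1 is cut off, and its largest element y_(m+1) determines
the cut. The sequences y that occur are exactly those whose intervals [j, y_j]
form a laminar family ([cut_spec], [falling_cut]). Choosing the y_j from right to
left, the possible values of y_j are j and the right ends that no interval chosen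
before hides; if there are s of them and the i-th is chosen, there are s - i + 2
for the next choice. This is the recursion of the ballot numbers, which gives
the Catalan number ([ballotE], [ballot1]). *)

Set Implicit Arguments.
Unset Strict Implicit.
Unset Printing Implicit Defensive.

(** * Minima of the cycles *)

Lemma porbit_closed (T : finType) (p : {perm T}) (P : pred T) (x y : T) :
  (forall u, P u -> P (p u)) -> P x -> y \in porbit p x -> P y.
Proof.
move=> clP Px /porbitP[i ->]; elim: i => [|i IHi]; first by rewrite perm1.
by rewrite expgSr permM; apply: clP.
Qed.

Lemma porbit_next (T : finType) (p : {perm T}) (x : T) : p x \in porbit p x.
Proof. exact: (mem_porbit p 1). Qed.

Lemma porbit_closedE (T : finType) (p : {perm T}) (P : pred T) (x y : T) :
  (forall u, P u -> P (p u)) -> y \in porbit p x -> P x = P y.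
Proof.
move=> clP xy; apply/idP/idP => [Px|Py]; first exact: porbit_closed clP Px xy.
by apply: porbit_closed clP Py _; rewrite porbit_sym.
Qed.

Definition cmin (n : nat) (p : 'S_n) (i : 'I_n) : 'I_n :=
  [arg min_(j < i in porbit p i) (j : nat)].

Definition mins (n : nat) (p : 'S_n) : {set 'I_n} := [set i | cmin p i == i].

Lemma cmin_spec n (p : 'S_n) i :
  cmin p i \in porbit p i /\ forall j, j \in porbit p i -> cmin p i <= j.
Proof.
by rewrite /cmin; case: arg_minnP => [|k ki kmin]; [apply: porbit_id | split].
Qed.

Lemma cmin_in n (p : 'S_n) i : cmin p i \in porbit p i.
Proof. by have [] := cmin_spec p i. Qed.

Lemma cmin_min n (p : 'S_n) i j : j \in porbit p i -> cmin p i <= j.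
Proof. by have [_] := cmin_spec p i; apply. Qed.

Lemma cmin_le n (p : 'S_n) i : cmin p i <= i.
Proof. by apply: cmin_min; apply: porbit_id. Qed.

Lemma eq_cmin n (p : 'S_n) i j : (cmin p i == cmin p j) = (i \in porbit p j).
Proof.
apply/eqP/idP => [eq_ij|]; last first.
  rewrite -eq_porbit_mem => /eqP eq_ij; apply/val_inj/eqP.
  by rewrite eqn_leq !cmin_min // -?eq_ij ?cmin_in // eq_ij cmin_in.
have := cmin_in p j; rewrite -eq_ij -!eq_porbit_mem => /eqP <-.
by rewrite eq_sym eq_porbit_mem cmin_in.
Qed.

Lemma cmin_perm n (p : 'S_n) i : cmin p (p i) = cmin p i.
Proof. by apply/eqP; rewrite eq_cmin porbit_next. Qed.

Lemma cmin_cmin n (p : 'S_n) i : cmin p (cmin p i) = cmin p i.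
Proof. by apply/eqP; rewrite eq_cmin cmin_in. Qed.

Lemma cmin_mins n (p : 'S_n) i : cmin p i \in mins p.
Proof. by rewrite inE cmin_cmin. Qed.

Lemma card_mins n (p : 'S_n) : #|mins p| = #|porbits p|.
Proof.
have -> : porbits p = porbit p @: mins p.
  apply/setP => A; apply/imsetP/imsetP => [] [i _ ->]; last by exists i.
  exists (cmin p i); first exact: cmin_mins.
  by apply/eqP; rewrite eq_porbit_mem porbit_sym cmin_in.
rewrite card_in_imset // => i j; rewrite !inE => /eqP mi /eqP mj /eqP.
by rewrite eq_porbit_mem -eq_cmin mi mj => /eqP.
Qed.

(** Products are from right to left, so x and y exchange their images. *)
Definition tmul (n : nat) (p : 'S_n) (x y : 'I_n) : 'S_n := compp p (tperm x y).

Lemma tmulL n (p : 'S_n) x y : tmul p x y x = p y.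
Proof. by rewrite permM tpermL. Qed.

Lemma tmulR n (p : 'S_n) x y : tmul p x y y = p x.
Proof. by rewrite permM tpermR. Qed.

Lemma tmulD n (p : 'S_n) x y u : u != x -> u != y -> tmul p x y u = p u.
Proof. by move=> ux uy; rewrite permM tpermD // eq_sym. Qed.

Lemma tmulC n (p : 'S_n) x y : tmul p x y = tmul p y x.
Proof. by rewrite /tmul tpermC. Qed.

Lemma tmulK n (p : 'S_n) x y : tmul (tmul p x y) x y = p.
Proof. by rewrite /tmul /compp mulgA tperm2 mul1g. Qed.

(** Multiplying by a transposition splits the cycle that contains both points,
and otherwise merges the two cycles; cycles are counted by their minima. *)
Lemma card_mins_tperm n (p : 'S_n) x y :
  #|mins (tmul p x y)| + (cmin p x != cmin p y).*2 = #|mins p| + (x != y).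
Proof. by rewrite !card_mins eq_cmin; exact: (porbits_mul_tperm p x y). Qed.

Lemma card_mins_merge n (p : 'S_n) x y :
  cmin p x != cmin p y -> (#|mins (tmul p x y)|).+1 = #|mins p|.
Proof.
move=> xy; have := card_mins_tperm p x y; rewrite xy.
have -> /= : x != y by apply: contra xy => /eqP ->.
lia.
Qed.

Lemma card_mins_split n (p : 'S_n) x y : x != y ->
  cmin p x = cmin p y -> #|mins (tmul p x y)| = (#|mins p|).+1.
Proof.
by move=> nxy xy; have := card_mins_tperm p x y; rewrite nxy xy eqxx /=; lia.
Qed.

Lemma card_mins_mul n (p : 'S_n) x y :
  #|mins (tmul p x y)| <= (#|mins p|).+1.
Proof. have := card_mins_tperm p x y; case: (x != y) => /=; lia. Qed.

(** If x and y stayed in different cycles, multiplying twice by the same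
transposition would lose two cycles. *)
Lemma cmin_merge_joint n (p : 'S_n) x y : cmin p x != cmin p y ->
  cmin (tmul p x y) x = cmin (tmul p x y) y.
Proof.
move=> nxy; apply/eqP; apply: contraT => nxy'.
have := card_mins_merge nxy; have := card_mins_merge nxy'.
by rewrite tmulK; lia.
Qed.

Lemma cmin_split_joint n (p : 'S_n) x y : x != y -> cmin p x = cmin p y ->
  cmin (tmul p x y) x != cmin (tmul p x y) y.
Proof.
move=> nxy xy; apply/eqP => xy'.
have := card_mins_split nxy xy; have := card_mins_split nxy xy'.
by rewrite tmulK; lia.
Qed.

(** The set of points in the new cycle of v is stable under p: at x and y,
where p differs from the product, both images lie in the common cycle of x
and y. *)
Lemma tmul_coarsen n (p : 'S_n) x y u v :
  cmin (tmul p x y) x = cmin (tmul p x y) y ->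
  cmin p u = cmin p v -> cmin (tmul p x y) u = cmin (tmul p x y) v.
Proof.
set q := tmul p x y => xy /eqP; rewrite eq_cmin => uv.
pose P (w : 'I_n) := cmin q w == cmin q v.
apply/eqP; apply: (@porbit_closed _ p P v u) => // [w /eqP wv|].
  rewrite /P -{}wv eq_sym.
  have [w_x|w_x] := eqVneq w x.
    by rewrite w_x -(tmulR p x y) cmin_perm -/q xy.
  have [w_y|w_y] := eqVneq w y.
    by rewrite w_y -(tmulL p x y) cmin_perm -/q xy.
  by rewrite -(tmulD p w_x w_y) cmin_perm.
by rewrite /P.
Qed.

(** The orientation of the hypothesis makes the cycle of x the one that loses
its minimum. The right-hand side is constant on the new cycles and names a
point of each. *)
Lemma cmin_merge n (p : 'S_n) x y u : cmin p y < cmin p x ->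
  cmin (tmul p x y) u = if cmin p u == cmin p x then cmin p y else cmin p u.
Proof.
move=> lt_yx; set q := tmul p x y.
have nxy : cmin p x != cmin p y by rewrite -(inj_eq val_inj) /=; lia.
have qxy : cmin q x = cmin q y by apply: cmin_merge_joint.
pose f (w : 'I_n) := if cmin p w == cmin p x then cmin p y else cmin p w.
have f_le w : f w <= cmin p w by rewrite /f; case: eqP => // ->; lia.
have fP w : cmin q (f w) = cmin q w.
  have e z : cmin q (cmin p z) = cmin q z by apply: tmul_coarsen; rewrite ?cmin_cmin.
  rewrite /f; case: eqP => [wx|_]; last exact: e.
  by rewrite e -qxy; apply: tmul_coarsen.
have f_q w : f (q w) = f w.
  rewrite /f permM cmin_perm; case: tpermP => [->|->|//].
    by rewrite eqxx if_same.
  by rewrite eqxx if_same.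
have f_orb v w : v \in porbit q w -> f v = f w.
  move=> vw; apply/eqP.
  by apply: (@porbit_closed _ q (fun v => f v == f w) w) => // a /eqP <-; rewrite f_q.
rewrite -/(f u); apply/val_inj/eqP; rewrite eqn_leq cmin_min ?andTb -?eq_cmin ?fP //.
by rewrite -(f_orb _ _ (cmin_in q u)) (leq_trans (f_le _)) ?cmin_le.
Qed.

Lemma mins_merge n (p : 'S_n) x y : cmin p y < cmin p x ->
  mins (tmul p x y) = mins p :\ cmin p x.
Proof.
move=> lt_yx; apply/setP => u; rewrite !inE cmin_merge //.
have [ux|ux] := eqVneq (cmin p u) (cmin p x).
  rewrite ux; have [->|] := eqVneq u (cmin p x).
    by rewrite /= -(inj_eq val_inj) /=; lia.
  move=> _ /=.
  apply/eqP => yu; move: ux; rewrite -yu cmin_cmin => /(congr1 val) /=; lia.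
have [uE|//] := eqVneq u (cmin p x).
by move: ux; rewrite uE cmin_cmin eqxx.
Qed.

(** * Absolute length and its order *)

Lemma comppA n (p q s : 'S_n) : compp (compp p q) s = compp p (compp q s).
Proof. by rewrite /compp mulgA. Qed.

Lemma compp1 n (p : 'S_n) : compp p 1%g = p.
Proof. by rewrite /compp mul1g. Qed.

Lemma comp1p n (p : 'S_n) : compp 1%g p = p.
Proof. by rewrite /compp mulg1. Qed.

Lemma comppKV n (p s : 'S_n) : compp p (compp p^-1%g s) = s.
Proof. by rewrite /compp mulgKV. Qed.

Lemma comppVK n (p s : 'S_n) : compp p^-1%g (compp p s) = s.
Proof. by rewrite /compp mulgK. Qed.

Lemma prodp_cat n (u v : seq 'S_n) : prodp (u ++ v) = compp (prodp u) (prodp v).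
Proof.
elim: u => [|t u IHu] /=; first by rewrite comp1p.
by rewrite -/(prodp _) IHu comppA.
Qed.

Lemma prodp_rcons n (w : seq 'S_n) t : prodp (rcons w t) = compp (prodp w) t.
Proof. by rewrite -cats1 prodp_cat /= compp1. Qed.

Lemma mem_transpositions n (t : 'S_n) : t \in transpositions n ->
  exists x y, x != y /\ t = tperm x y.
Proof. by case/imsetP => [[x y]]; rewrite inE /= => nxy ->; exists x, y. Qed.

Lemma tperm_transpositions n (x y : 'I_n) :
  x != y -> tperm x y \in transpositions n.
Proof. by move=> nxy; apply/imsetP; exists (x, y); rewrite // inE. Qed.

Lemma has_TwordP n (p : 'S_n) k :
  reflect (exists w : seq 'S_n,
             [/\ all [in transpositions n] w, prodp w = p & size w = k])
          (has_Tword p k).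
Proof.
apply: (iffP existsP) => [[w /andP[aw /eqP pw]]|[w [aw pw sw]]].
  by exists w; rewrite size_tuple.
have sw' : size w == k by rewrite sw.
by exists (Tuple sw'); rewrite /= aw pw eqxx.
Qed.

Lemma ellT_word n (p : 'S_n) :
  exists w : seq 'S_n, [/\ all [in transpositions n] w, prodp w = p & size w = ellT p].
Proof. by rewrite /ellT; case: ex_minnP => k /has_TwordP. Qed.

Lemma ellT_le n (w : seq 'S_n) :
  all [in transpositions n] w -> ellT (prodp w) <= size w.
Proof.
move=> aw; rewrite /ellT; case: ex_minnP => k _; apply.
by apply/has_TwordP; exists w.
Qed.

Lemma ellT_compp n (p s : 'S_n) : ellT (compp p s) <= ellT p + ellT s.
Proof.
have [u [au <- <-]] := ellT_word p; have [v [av <- <-]] := ellT_word s.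
by rewrite -prodp_cat -size_cat ellT_le // all_cat au av.
Qed.

Lemma card_mins1 n : #|mins (1 : 'S_n)%g| = n.
Proof.
rewrite -[RHS]card_ord -cardsT; congr #|pred_of_set _|.
apply/setP => i; rewrite !inE; apply/eqP/esym.
have/porbitP[k ->] := cmin_in (1 : 'S_n)%g i.
by rewrite expg1n perm1.
Qed.

Lemma card_mins_max n (p : 'S_n) : #|mins p| <= n.
Proof. by rewrite -[leqRHS]card_ord max_card. Qed.

(** Each factor lowers the number of cycles by one at most. *)
Lemma card_mins_prodp n (w : seq 'S_n) : all [in transpositions n] w ->
  n <= #|mins (prodp w)| + size w.
Proof.
elim/last_ind: w => [|w t IHw]; first by rewrite card_mins1 leq_addr.
rewrite all_rcons prodp_rcons size_rcons => /andP[/mem_transpositions].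
case=> x [y [_ ->]] /IHw; rewrite -/(tmul (prodp w) x y).
have := card_mins_mul (tmul (prodp w) x y) x y; rewrite tmulK; lia.
Qed.

(** Multiplying by the transposition of x and p x makes x a fixed point, so
repeating this reaches the identity with one transposition for each cycle
gained. *)
Lemma mins_word n (p : 'S_n) : exists w : seq 'S_n,
  [/\ all [in transpositions n] w, prodp w = p & size w + #|mins p| = n].
Proof.
have [k] := ubnP (n - #|mins p|); elim: k p => // k IHk p lek.
have [->|/eqP p1] := eqVneq p 1%g; first by exists [::]; rewrite /= card_mins1.
have [x px] : exists x, p x != x.
  apply/existsP; apply: contra_notT p1 => /existsPn px.
  by apply/permP => x; rewrite perm1; apply/eqP; rewrite -[_ == _]negbK px.
have xy : x != p x by rewrite eq_sym.
have sp : cmin p x = cmin p (p x) by rewrite cmin_perm.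
have e := card_mins_split xy sp; have := card_mins_max (tmul p x (p x)).
rewrite e => le; have [|w [aw pw sw]] := IHk (tmul p x (p x)).
  by rewrite e; lia.
exists (rcons w (tperm x (p x))); split.
- by rewrite all_rcons aw tperm_transpositions.
- by rewrite prodp_rcons pw -/(tmul _ _ _) tmulK.
by rewrite size_rcons; lia.
Qed.

(** The length and the number of cycles are complementary: this turns every
statement on reduced words into one on cycle minima. *)
Lemma ellT_mins n (p : 'S_n) : ellT p + #|mins p| = n.
Proof.
have [w [aw pw sw]] := mins_word p; have := ellT_le aw; rewrite pw => le1.
have [v [av pv sv]] := ellT_word p; have := card_mins_prodp av.
by rewrite pv; lia.
Qed.

Lemma ellT1 n : ellT (1 : 'S_n)%g = 0.
Proof. by have := ellT_mins (1 : 'S_n)%g; rewrite card_mins1; lia. Qed.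

Lemma ellT_eq0 n (p : 'S_n) : ellT p = 0 -> p = 1%g.
Proof. by have [w [_ <- <-]] := ellT_word p; move=> /size0nil ->. Qed.

(** These are the covers of the absolute order; the form records which two
cycles are merged and which of them keeps its minimum. *)
Definition covers n (p q : 'S_n) : Prop :=
  exists x y, cmin p y < cmin p x /\ q = tmul p x y.

Lemma covers_mins n (p q : 'S_n) : covers p q ->
  exists2 a, a \in mins p & mins q = mins p :\ a.
Proof.
by move=> [x [y [lt ->]]]; exists (cmin p x); rewrite ?cmin_mins ?mins_merge.
Qed.

Lemma covers_card n (p q : 'S_n) : covers p q -> #|mins p| = (#|mins q|).+1.
Proof. by case/covers_mins => a ap ->; rewrite (cardsD1 a (mins p)) ap. Qed.

Lemma covers_ellT n (p q : 'S_n) : covers p q -> ellT q = (ellT p).+1.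
Proof. move=> /covers_card; have := ellT_mins p; have := ellT_mins q; lia. Qed.

Lemma tmul_covers n (p : 'S_n) x y :
  ellT (tmul p x y) = (ellT p).+1 -> covers p (tmul p x y).
Proof.
move=> e; have {e}: #|mins p| = (#|mins (tmul p x y)|).+1.
  by have := ellT_mins p; have := ellT_mins (tmul p x y); lia.
have := card_mins_tperm p x y.
have [lt|lt|/val_inj ->] := ltngtP (cmin p x) (cmin p y).
- by move=> _ _; exists y, x; rewrite tmulC.
- by move=> _ _; exists x, y.
by rewrite eqxx /=; lia.
Qed.

Lemma leTxx n (p : 'S_n) : leT p p.
Proof. by rewrite /leT /compp mulgV ellT1 addn0. Qed.

Lemma leT_ellT n (p s : 'S_n) : leT p s -> ellT p <= ellT s.
Proof. by move/eqP <-; rewrite leq_addr. Qed.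

Lemma leT_eq n (p s : 'S_n) : leT p s -> ellT s <= ellT p -> p = s.
Proof.
move=> /eqP e le; have /ellT_eq0 e1 : ellT (compp p^-1%g s) = 0 by lia.
by rewrite -(comppKV p s) e1 compp1.
Qed.

Lemma leT_trans n (p s u : 'S_n) : leT p s -> leT s u -> leT p u.
Proof.
move=> /eqP eps /eqP esu; rewrite /leT eqn_leq -{3}(comppKV p u) ellT_compp andbT.
have := ellT_compp (compp p^-1%g s) (compp s^-1%g u).
by rewrite comppA comppKV; lia.
Qed.

Lemma leT1p n (p : 'S_n) : leT 1%g p.
Proof. by rewrite /leT ellT1 invg1 comp1p. Qed.

Lemma covers_leT n (p q : 'S_n) : covers p q -> leT p q.
Proof.
move=> cpq; have := covers_ellT cpq; case: cpq => x [y [lt ->]] e.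
rewrite /leT eqn_leq -{3}(comppKV p (tmul p x y)) ellT_compp andbT.
rewrite comppVK e -addn1 leq_add2l -[tperm x y]compp1.
apply: (@ellT_le _ [:: tperm x y]); rewrite /= andbT tperm_transpositions //.
by apply: contraTneq lt => ->; rewrite ltnn.
Qed.

(** The first letter of a reduced word of p^-1 s gives the cover. *)
Lemma leT_step n (p s : 'S_n) : leT p s -> ellT p < ellT s ->
  exists2 q, covers p q & leT q s.
Proof.
move=> /eqP e lt; have [[|t w] [aw pw sw]] := ellT_word (compp p^-1%g s).
  by move: sw => /=; lia.
move: aw => /= /andP[/mem_transpositions[x [y [nxy tE]]] aw].
have qs : compp (tmul p x y)^-1%g s = prodp w.
  by rewrite -(comppKV p s) -pw /= tE -/(prodp w) -(comppA p) -/(tmul p x y) comppVK.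
have e1 := ellT_le aw; have e2 := ellT_compp (tmul p x y) (prodp w).
rewrite -{1}qs comppKV in e2.
have e3 : ellT (tperm x y) <= 1.
  rewrite -[tperm x y]compp1; apply: (@ellT_le _ [:: tperm x y]).
  by rewrite /= andbT tperm_transpositions.
have e4 := ellT_compp p (tperm x y); rewrite -/(tmul p x y) in e4.
rewrite /= in sw.
exists (tmul p x y); first by apply: tmul_covers; lia.
by rewrite /leT qs; apply/eqP; lia.
Qed.

Lemma leT_covers n (p s : 'S_n) : leT p s -> ellT s = (ellT p).+1 -> covers p s.
Proof.
move=> le e; have [|q cpq qs] := leT_step le; first by rewrite e.
by rewrite -(leT_eq qs) // e (covers_ellT cpq).
Qed.

(** * Noncrossing permutations *)

(** Membership of u in the cyclic interval strictly between i and j. For i = j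
it is everything but i, so that a fixed point also cuts the circle at one
place. *)
Definition between (i j u : nat) : bool :=
  [|| i < u < j, (j <= i < u) | (u < j <= i)].

(** The arc from i to p i separates no cycle of p. This says at once that the
cycles of p are pairwise noncrossing and that p turns each of them in
increasing cyclic order; it is exactly what the splitting argument below
preserves. *)
Definition noncrossing n (p : 'S_n) : Prop :=
  forall i u : 'I_n, between i (p i) u -> between i (p i) (p u).

Lemma nc_same n (p : 'S_n) (i u v : 'I_n) : noncrossing p -> cmin p u = cmin p v ->
  between i (p i) u = between i (p i) v.
Proof.
move=> ncp /eqP; rewrite eq_cmin porbit_sym => uv.
by apply: (@porbit_closedE _ p (fun w => between i (p i) w)) uv => w; apply: ncp.
Qed.

Lemma nc_span n (p : 'S_n) (i v : 'I_n) : noncrossing p -> p i <= i ->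
  cmin p v = cmin p i -> p i <= v <= i.
Proof.
move=> ncp le /(nc_same i ncp); rewrite /between; lia.
Qed.

(** An arc that goes back closes its cycle: the whole cycle lies between its
two ends. *)
Lemma nc_back n (p : 'S_n) (i : 'I_n) : noncrossing p -> p i <= i -> p i = cmin p i.
Proof.
move=> ncp le; apply/val_inj/eqP; rewrite eqn_leq.
have /(nc_span ncp le)/andP[-> _] := cmin_cmin p i.
by rewrite -cmin_perm cmin_le.
Qed.

(** A cycle in increasing cyclic order through a and b is cut by letting a
jump to the successor pb of b. An arc from u to pu that leaves the
interval from a to pb passes over b without passing over a, or else leaves
the interval from b to pb. *)
Lemma between_cut (a b pb u pu : nat) :
  a <> b -> u <> b -> u <> a -> pu <> pb ->
  between b pb a = false -> between u pu a = between u pu b ->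
  between b pb u = between b pb pu -> between a pb u -> between a pb pu.
Proof.
move=> ab ub ua pub; rewrite /between.
case: (ltngtP a b) ab => // ab _; case: (ltngtP u b) ub => // ub _;
  case: (ltngtP u a) ua => // ua _; case: (ltngtP pu pb) pub => // pub _; lia.
Qed.

Lemma between_cut_end (a b pa pb : nat) : a <> b -> pa <> pb ->
  between a pa b = false -> between b pb a = false ->
  between a pb b -> between a pb pa.
Proof. by rewrite /between; lia. Qed.

Lemma between_id i j : between i j i = false.
Proof. by rewrite /between; lia. Qed.

(** The arcs that do not leave x or y are arcs of p, whose intervals contain
both of x and y or neither. The two new arcs are treated by [between_cut]. *)
Lemma nc_split n (p : 'S_n) x y : noncrossing p -> x != y ->
  cmin p x = cmin p y -> noncrossing (tmul p x y).
Proof.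
move=> ncp.
(* the arcs of [tmul p x y] that leave x; those that leave y follow by symmetry *)
have main (a b u : 'I_n) : a != b -> cmin p a = cmin p b ->
    between a (p b) u -> between a (p b) (tmul p a b u).
  move=> nab eab.
  have ab (i : 'I_n) : between i (p i) a = between i (p i) b by apply: nc_same.
  have S (i w : 'I_n) : between i (p i) w = between i (p i) (p w).
    by apply: nc_same; rewrite ?cmin_perm.
  have inj (v w : 'I_n) : v != w -> (v <> w :> nat) * (p v <> p w :> nat).
    by move/eqP => nvw; split=> [/val_inj|/val_inj/perm_inj].
  have [->|ua] := eqVneq u a; first by rewrite between_id.
  have [->|ub] := eqVneq u b.
    rewrite tmulR; apply: (between_cut_end (inj _ _ nab).1 (inj _ _ nab).2).
      by rewrite -ab between_id.
    by rewrite ab between_id.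
  rewrite tmulD //; apply: (between_cut (inj _ _ nab).1 (inj _ _ ub).1 (inj _ _ ua).1).
  - exact: (inj _ _ ub).2.
  - by rewrite ab between_id.
  - exact: ab.
  - exact: S.
move=> nxy exy i u; have [->|ix] := eqVneq i x; first by rewrite tmulL; apply: main.
have [->|iy] := eqVneq i y.
  by rewrite tmulR tmulC; apply: main; rewrite // eq_sym.
rewrite tmulD // => bu.
have [ux|ux] := eqVneq u x.
  by rewrite ux tmulL; apply: (ncp); rewrite -(nc_same i ncp exy) -ux.
have [uy|uy] := eqVneq u y.
  by rewrite uy tmulR; apply: (ncp); rewrite (nc_same i ncp exy) -uy.
by rewrite tmulD //; apply: ncp.
Qed.

Lemma long_cycleE n (i : 'I_n) : long_cycle n i = ordS i.
Proof. by rewrite permE. Qed.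

Lemma val_ordS n (i : 'I_n) : ordS i = (if i.+1 == n then 0 else i.+1) :> nat.
Proof.
rewrite /=; have := ltn_ord i; case: eqP => [->|ne lt]; first by rewrite modnn.
by rewrite modn_small; lia.
Qed.

Lemma nc_long_cycle n : noncrossing (long_cycle n).
Proof.
move=> i u; rewrite !long_cycleE /between !val_ordS.
have := ltn_ord i; have := ltn_ord u.
by do 2 case: eqP => ? /=; lia.
Qed.

(** Going down from s, each cover splits a cycle. *)
Lemma leT_nc n (p s : 'S_n) : leT p s -> noncrossing s -> noncrossing p.
Proof.
move=> le ncs; have [k] := ubnP (ellT s - ellT p).
elim: k p le => // k IHk p le lek.
have [lt|ge] := ltnP (ellT p) (ellT s); last by rewrite (leT_eq le ge).
have [q cpq qs] := leT_step le lt; have eq1 := covers_ellT cpq.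
have ncq : noncrossing q by apply: IHk => //; lia.
case: cpq => x [y [ltxy qE]].
have nxy : cmin p x != cmin p y by apply: contraTneq ltxy => ->; rewrite ltnn.
rewrite -(tmulK p x y) -qE; apply: nc_split => //.
  by apply: contraNneq nxy => ->.
by rewrite qE cmin_merge_joint.
Qed.

Lemma NC_nc n (p : 'S_n) : p \in NC n -> noncrossing p.
Proof. by rewrite inE => /leT_nc; apply; apply: nc_long_cycle. Qed.

(** If p x > x, the interval from x to p x is free of the cycle of x. The arc
of the product from x to p y must not pass over p x, which now lies in the
cycle of x, so p y falls into that interval, and with it the whole cycle
of y. This contradicts that its minimum is less than that of x. *)
Lemma merge_at_max n (p : 'S_n) x y : noncrossing p -> noncrossing (tmul p x y) ->
  cmin p y < cmin p x -> p x = cmin p x.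
Proof.
move=> ncp ncq lt; apply: nc_back => //; rewrite leqNgt; apply/negP => ltx.
have nxy : cmin p x != cmin p y by apply: contraTneq lt => ->; rewrite ltnn.
have qxy := cmin_merge_joint nxy.
have := nc_same x ncq (etrans (cmin_perm (tmul p x y) y) (esym qxy)).
rewrite tmulL tmulR.
have nyx : p y <> p x :> nat.
  by move/val_inj/perm_inj => yx; rewrite yx eqxx in nxy.
have := nc_same x ncp (cmin_cmin p y); have := nc_same x ncp (cmin_perm p y).
have := cmin_le p x; rewrite /between; lia.
Qed.

Lemma merge_at n (p : 'S_n) x y : noncrossing p -> noncrossing (tmul p x y) ->
  cmin p y < cmin p x -> x = p^-1%g (cmin p x).
Proof. by move=> ncp ncq lt; rewrite -(merge_at_max ncp ncq lt) permK. Qed.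

(** * Rank-two intervals *)

Lemma tmul_swapL n (p : 'S_n) x y z w : tmul (tmul p x y) z w =
  tmul (tmul p z w) (tperm z w x) (tperm z w y).
Proof.
rewrite /tmul /compp -tpermJ /conjg tpermV -!mulgA.
by rewrite (mulgA (tperm z w) (tperm z w) p) tperm2 mul1g.
Qed.

Lemma tmul_swapR n (p : 'S_n) x y z w : tmul (tmul p x y) z w =
  tmul (tmul p (tperm x y z) (tperm x y w)) x y.
Proof. by rewrite /tmul /compp -tpermJ /conjg tpermV !mulgA tperm2 mul1g. Qed.

Lemma merge_covers n (p : 'S_n) x y : cmin p y < cmin p x -> covers p (tmul p x y).
Proof. by exists x, y. Qed.

(** The new element loses a minimum that q keeps, so its label differs from
that of q. *)
Lemma exchange_with n (p q r : 'S_n) a b c d :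
  covers p q -> covers q r -> cmin p b < cmin p a -> cmin p a \in mins q ->
  r = tmul (tmul p a b) c d ->
  exists q', [/\ covers p q', covers q' r & mins q' != mins q].
Proof.
move=> pq qr lt aq rE; exists (tmul p a b); split; first exact: merge_covers.
  rewrite rE; apply: tmul_covers; rewrite -rE (covers_ellT qr) (covers_ellT pq).
  by rewrite (covers_ellT (merge_covers lt)).
by rewrite mins_merge //; apply: contraTneq aq => <-; rewrite !inE eqxx.
Qed.

(** Let q merge x with y and r further merge z with w. Other elements of the
interval are obtained by performing the second merge first, or its
conjugate by the first transposition. Only one case resists the former:
both merges attach the same cycle B to cycles of smaller minimum. Then
both happen at the largest point of B, the two transpositions share that
point, and the conjugate joins the two cycles of smaller minimum. *)
Lemma exchange n (p q r : 'S_n) : noncrossing r -> covers p q -> covers q r ->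
  exists q', [/\ covers p q', covers q' r & mins q' != mins q].
Proof.
move=> ncr pq qr; have [x [y [ltxy qE]]] := pq; have [z [w [ltzw rE]]] := qr.
have ncq := leT_nc (covers_leT qr) ncr; have ncp := leT_nc (covers_leT pq) ncq.
have inq a : cmin p a != cmin p x -> cmin p a \in mins q.
  by move=> ax; rewrite qE mins_merge // in_setD1 ax cmin_mins.
have muq u : cmin q u = if cmin p u == cmin p x then cmin p y else cmin p u.
  by rewrite qE cmin_merge.
have xE : x = p^-1%g (cmin p x) by apply: merge_at ltxy => //; rewrite -qE.
have eL : r = tmul (tmul p z w) (tperm z w x) (tperm z w y).
  by rewrite rE qE tmul_swapL.
have eR : r = tmul (tmul p (tperm x y z) (tperm x y w)) x y.
  by rewrite rE qE tmul_swapR.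
(* any other merge of the cycle of x into one below it also happens at x *)
have at_x a b : a \in [:: z; w] -> b \in [:: z; w] -> a != b ->
    cmin p a = cmin p x -> cmin p b < cmin p a -> a = x.
  move=> az bz nab ax lt; rewrite xE -ax; apply: (@merge_at _ p a b) => //.
  suffices -> : tmul p a b = tmul p z w.
    have abw : cmin p z != cmin p w.
      case: (negPf nab) az bz lt => _; rewrite !inE.
      by case/orP => /eqP -> /orP[] /eqP ->; rewrite ?ltnn // => lt;
        apply: contraTneq lt => ->; rewrite ltnn.
    have c : ellT (tmul p z w) = (ellT p).+1.
      have := ellT_mins p; have := ellT_mins (tmul p z w).
      by have := card_mins_merge abw; lia.
    apply: leT_nc ncr; apply: covers_leT; rewrite eL; apply: tmul_covers.
    by rewrite -eL c (covers_ellT qr) (covers_ellT pq).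
  move: az bz nab; rewrite !inE.
  by case/orP => /eqP -> /orP[] /eqP ->; rewrite ?eqxx // tmulC.
have nzw : z != w by apply: contraTneq ltzw => ->; rewrite ltnn.
have nwz : w != z by rewrite eq_sym.
have lt_ne (a b : 'I_n) : a < b -> (a != b) * (b != a).
  by move=> lt; rewrite -!(inj_eq val_inj) /=; split; lia.
have [zx|zx] := eqVneq (cmin p z) (cmin p x).
  have [wx|wx] := eqVneq (cmin p w) (cmin p x).
    by move: ltzw; rewrite !muq zx wx eqxx ltnn.
  have ltwy : cmin p w < cmin p y by move: ltzw; rewrite !muq zx eqxx (negPf wx).
  have zE : z = x.
    by apply: (at_x z w); rewrite ?inE ?eqxx ?orbT // zx; apply: ltn_trans ltxy.
  have [wy ny] := (lt_ne _ _ ltwy, lt_ne _ _ ltxy).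
  have wE : tperm x y w = w.
    by apply: tpermD; apply: contraNneq wx => e; move: wy; rewrite -e ?eqxx //= => -[].
  move: eR; rewrite zE tpermL wE => eR.
  by apply: (exchange_with pq qr ltwy) eR; apply: inq; rewrite ny.
rewrite !muq (negPf zx) in ltzw.
have [ltpwz|] := ltnP (cmin p w) (cmin p z).
  by apply: (exchange_with pq qr ltpwz) eL; apply: inq.
have [wx|wx] := eqVneq (cmin p w) (cmin p x); last first.
  by move: ltzw; rewrite (negPf wx) => ltzw; rewrite leqNgt ltzw.
rewrite wx eqxx in ltzw *; rewrite leq_eqVlt val_eqE (negPf zx) /= => ltzx.
have wE : w = x by apply: (at_x w z); rewrite ?inE ?eqxx ?orbT // wx.
have zE : tperm x y z = z.
  apply: tpermD; first by apply: contraNneq zx => ->.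
  by apply: contraTneq ltzw => ->; rewrite ltnn.
move: eR; rewrite wE tpermL zE => eR.
by apply: (exchange_with pq qr ltzw) eR; apply: inq.
Qed.

(** * Maximal chains as saturated sequences *)

Lemma cmin_long_cycle N (i : 'I_N.+1) : cmin (long_cycle N.+1) i = ord0.
Proof.
have mu0 : cmin (long_cycle N.+1) ord0 = ord0.
  by apply/val_inj/eqP; rewrite /= -leqn0; apply: (cmin_le _ (ord0 : 'I_N.+1)).
case: i => i lti; elim: i lti => [|i IHi] lti.
  by rewrite -[RHS]mu0; congr cmin; apply: val_inj.
rewrite -(IHi (ltnW lti)) -[RHS]cmin_perm; congr cmin; apply: ord_inj.
by rewrite long_cycleE val_ordS /=; case: eqP lti => // ->; rewrite ltnn.
Qed.

Lemma mins_long_cycle N : mins (long_cycle N.+1) = [set ord0].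
Proof. by apply/setP => i; rewrite !inE cmin_long_cycle eq_sym. Qed.

Lemma ellT_long_cycle N : ellT (long_cycle N.+1) = N.
Proof.
by have := ellT_mins (long_cycle N.+1); rewrite mins_long_cycle cards1; lia.
Qed.

(** A maximal chain read by rank, as a sequence: unlike the set, it gives each
label a position. *)
Definition saturated N (r : nat -> 'S_N.+1) : Prop :=
  (forall k, k < N -> covers (r k) (r k.+1)) /\ r N = long_cycle N.+1.

Definition chain_set N (r : nat -> 'S_N.+1) : {set 'S_N.+1} :=
  [set r k | k : 'I_N.+1].

Lemma chain_setP N (r : nat -> 'S_N.+1) p :
  reflect (exists2 k, k <= N & p = r k) (p \in chain_set r).
Proof.
apply: (iffP imsetP) => [[k _ ->]|[k le ->]]; first by exists k; rewrite // -ltnS.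
by exists (Ordinal (le : k < N.+1)).
Qed.

Lemma sat_ellT N (r : nat -> 'S_N.+1) k : saturated r -> k <= N -> ellT (r k) = k.
Proof.
move=> [cr rN].
have e j : j <= N -> ellT (r j) = ellT (r 0) + j.
  elim: j => [|j IHj] lej; first by rewrite addn0.
  by rewrite (covers_ellT (cr j lej)) IHj ?addnS // ltnW.
by move=> lek; have := e N (leqnn N); rewrite rN ellT_long_cycle (e k lek); lia.
Qed.

Lemma sat_leT N (r : nat -> 'S_N.+1) j k :
  saturated r -> j <= k <= N -> leT (r j) (r k).
Proof.
move=> [cr _]; elim: k => [|k IHk] /andP[lejk lek].
  by move: lejk; rewrite leqn0 => /eqP ->; apply: leTxx.
move: lejk; rewrite leq_eqVlt => /orP[/eqP -> |lejk]; first exact: leTxx.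
apply: leT_trans (covers_leT (cr k lek)); apply: IHk.
by rewrite -ltnS lejk ltnW.
Qed.

Lemma sat_NC N (r : nat -> 'S_N.+1) k : saturated r -> k <= N -> r k \in NC N.+1.
Proof.
by move=> sr lek; rewrite inE -sr.2 sat_leT // lek leqnn.
Qed.

Lemma sat_nc N (r : nat -> 'S_N.+1) k : saturated r -> k <= N -> noncrossing (r k).
Proof. by move=> sr lek; apply/NC_nc/sat_NC. Qed.

Lemma sat_max N (r : nat -> 'S_N.+1) : saturated r -> chain_set r \in max_chains N.+1.
Proof.
move=> sr; rewrite inE; apply/maxsetP; split => [|D /andP[DNC chD] rD].
  apply/andP; split; first by apply/subsetP => _ /chain_setP[k lek ->]; apply: sat_NC.
  apply/forall_inP => _ /chain_setP[j lej ->].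
  apply/forall_inP => _ /chain_setP[k lek ->].
  have [le|le] := leqP j k; first by rewrite sat_leT // le.
  by rewrite orbC sat_leT // lej ltnW.
apply/eqP; rewrite eqEsubset rD andbT; apply/subsetP => p pD.
have pNC := subsetP DNC _ pD; have lep : ellT p <= N.
  by move: pNC; rewrite inE => /leT_ellT; rewrite ellT_long_cycle.
have rpD : r (ellT p) \in D by apply: (subsetP rD); apply/chain_setP; exists (ellT p).
apply/chain_setP; exists (ellT p) => //; have e := sat_ellT sr lep.
have := forall_inP (forall_inP chD _ pD) _ rpD.
case/orP => [/leT_eq|/leT_eq h]; first by apply; rewrite e.
by apply/esym/h; rewrite e.
Qed.

Lemma max_chain_spec n (v : {set 'S_n}) : v \in max_chains n ->
  [/\ forall p, p \in v -> p \in NC n,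
      forall p s, p \in v -> s \in v -> leT p s || leT s p &
      forall q, q \in NC n -> (forall u, u \in v -> leT q u || leT u q) -> q \in v].
Proof.
rewrite inE => /maxsetP[/andP[/subsetP vNC chv] vmax].
have chv' p s : p \in v -> s \in v -> leT p s || leT s p.
  by move=> pv sv; apply: (forall_inP (forall_inP chv _ pv)).
split=> // q qNC chq; rewrite -(vmax (q |: v)) ?setU11 ?subsetUr //.
apply/andP; split; first by apply/subsetP => u /setU1P[->|/vNC].
apply/forall_inP => a /setU1P[->|av]; apply/forall_inP => b /setU1P[->|bv].
- by rewrite leTxx.
- exact: chq.
- by rewrite orbC chq.
exact: chv'.
Qed.

(** Above the element of rank k of the chain take the next element s of the
chain. If the ranks skipped k + 1, a cover of the former below s would be
comparable with the whole chain. *)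
Lemma max_chain_rank N (v : {set 'S_N.+1}) k : v \in max_chains N.+1 -> k <= N ->
  exists2 p, p \in v & ellT p = k.
Proof.
move=> /max_chain_spec[vNC chv vmax].
have vc p : p \in v -> leT p (long_cycle N.+1) by move/vNC; rewrite inE.
have cv : long_cycle N.+1 \in v.
  by apply: vmax => [|u uv]; rewrite ?inE ?leTxx // vc ?orbT.
elim: k => [|k IHk] lek.
  exists 1%g; last exact: ellT1.
  by apply: vmax => [|u uv]; rewrite ?inE leT1p.
have [p pv pk] := IHk (ltnW lek).
pose P s := (s \in v) && (k < ellT s).
have Pc : P (long_cycle N.+1) by rewrite /P cv ellT_long_cycle.
case: (arg_minnP (@ellT N.+1) Pc) => s /andP[sv ks] smin.
have ps : leT p s.
  by case/orP: (chv p s pv sv) => // /leT_ellT; rewrite pk leqNgt ks.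
have [|q pq qs] := leT_step ps; first by rewrite pk.
exists q; last by rewrite (covers_ellT pq) pk.
apply: vmax => [|u uv]; first by rewrite inE (leT_trans qs) ?vc.
have [le|lt] := leqP (ellT u) k.
  have up : leT u p.
    case/orP: (chv u p uv pv) => // pu.
    by rewrite (leT_eq pu) ?leTxx // pk.
  by rewrite (leT_trans up (covers_leT pq)) orbT.
have su : leT s u.
  case/orP: (chv u s uv sv) => // us.
  by rewrite (leT_eq us) ?leTxx // smin // /P uv.
by rewrite (leT_trans qs su).
Qed.

Lemma max_chainP N (v : {set 'S_N.+1}) : v \in max_chains N.+1 ->
  exists2 r, saturated r & v = chain_set r.
Proof.
move=> vm; have [vNC chv vmax] := max_chain_spec vm.
have ex k : exists p, k <= N -> p \in v /\ ellT p = k.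
  have [lek|] := leqP k N; last by exists 1%g.
  by have [p pv pk] := max_chain_rank vm lek; exists p.
have [r rP] := choice ex.
have rk p : p \in v -> p = r (ellT p).
  move=> pv; have lep : ellT p <= N.
    by have := vNC _ pv; rewrite inE => /leT_ellT; rewrite ellT_long_cycle.
  have [rv re] := rP _ lep.
  case/orP: (chv _ _ pv rv) => [/leT_eq|/leT_eq h]; first by apply; rewrite re.
  by apply/esym/h; rewrite re.
have sr : saturated r.
  split=> [k ltk|].
    have [rv re] := rP k (ltnW ltk); have [rv' re'] := rP k.+1 ltk.
    apply: leT_covers; last by rewrite re re'.
    by case/orP: (chv _ _ rv rv') => // /leT_ellT; rewrite re re' ltnn.
  apply: leT_eq; last by rewrite ellT_long_cycle (rP N (leqnn N)).2.
  by have := vNC _ (rP N (leqnn N)).1; rewrite inE.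
exists r => //; apply/eqP; rewrite eqEsubset; apply/andP; split; apply/subsetP => p.
  move=> pv; apply/chain_setP; exists (ellT p); last exact: rk.
  by have := vNC _ pv; rewrite inE => /leT_ellT; rewrite ellT_long_cycle.
by case/chain_setP => k lek ->; apply: (rP k lek).1.
Qed.

Lemma chain_set_eq N (r r' : nat -> 'S_N.+1) : saturated r -> saturated r' ->
  (chain_set r = chain_set r' <-> forall k, k <= N -> r k = r' k).
Proof.
move=> sr sr'; split=> [e k lek|e]; last first.
  by apply: eq_imset => k; rewrite e // -ltnS.
have /chain_setP[j lej rj] : r k \in chain_set r'.
  by rewrite -e; apply/chain_setP; exists k.
by have := sat_ellT sr lek; rewrite rj (sat_ellT sr' lej) => ->.
Qed.

(** * Labels and inversions *)

Lemma mins0 N (p : 'S_N.+1) : ord0 \in mins p.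
Proof. by rewrite inE -val_eqE /= -leqn0 (cmin_le _ (ord0 : 'I_N.+1)). Qed.

Lemma sat0 N (r : nat -> 'S_N.+1) : saturated r -> r 0 = 1%g.
Proof. by move=> sr; apply/ellT_eq0/sat_ellT. Qed.

Lemma sat_mins_sub N (r : nat -> 'S_N.+1) j k a : saturated r -> j <= k <= N ->
  a \in mins (r k) -> a \in mins (r j).
Proof.
move=> sr; elim: k => [|k IHk] /andP[lejk lek].
  by move: lejk; rewrite leqn0 => /eqP ->.
move: lejk; rewrite leq_eqVlt => /orP[/eqP -> //|lejk].
have [b _ ->] := covers_mins (sr.1 k lek); rewrite in_setD1 => /andP[_].
by apply: IHk; rewrite -ltnS lejk ltnW.
Qed.

(** In a saturated sequence there is exactly one candidate below rank N. *)
Definition label N (r : nat -> 'S_N.+1) k : 'I_N.+1 :=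
  odflt ord0 [pick a in mins (r k) :\: mins (r k.+1)].

Lemma label_spec N (r : nat -> 'S_N.+1) k : saturated r -> k < N ->
  label r k \in mins (r k) /\ mins (r k.+1) = mins (r k) :\ label r k.
Proof.
move=> sr ltk; have [a ap e] := covers_mins (sr.1 k ltk).
suffices -> : label r k = a by [].
rewrite /label; case: pickP => [b|/(_ a)]; rewrite e !inE; last first.
  by move: ap; rewrite inE eqxx => ->.
by case: eqP => //= _; rewrite andNb.
Qed.

Lemma label_in N (r : nat -> 'S_N.+1) j k : saturated r -> j <= k < N ->
  label r k \in mins (r j).
Proof.
move=> sr /andP[lejk ltk]; apply: (@sat_mins_sub _ _ j k) => //.
  by rewrite lejk ltnW.
exact: (label_spec sr ltk).1.
Qed.

Lemma label_notin N (r : nat -> 'S_N.+1) j k : saturated r -> j < k <= N ->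
  label r j \notin mins (r k).
Proof.
move=> sr /andP[ltjk lek]; have ltj : j < N by apply: leq_trans lek.
apply/negP => /(@sat_mins_sub _ _ j.+1 k _ sr); rewrite ltjk lek => /(_ isT).
by rewrite (label_spec sr ltj).2 !inE eqxx.
Qed.

Lemma label_gt0 N (r : nat -> 'S_N.+1) k : saturated r -> k < N -> 0 < label r k.
Proof.
move=> sr ltk; have := mins0 (r k.+1); rewrite (label_spec sr ltk).2 in_setD1.
by case/andP => + _; rewrite -val_eqE /= lt0n eq_sym.
Qed.

Lemma label_neq N (r : nat -> 'S_N.+1) k : saturated r -> k.+1 < N ->
  label r k <> label r k.+1 :> nat.
Proof.
move=> sr ltk /ord_inj e; have := @label_notin _ _ k k.+1 sr; rewrite leqnn ltnW //.
by move=> /(_ isT); rewrite e label_in // leqnn.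
Qed.

(** Inversions of the label sequence, read off the chain as a set: b is lost
before a iff some element has a, but not b, among its cycle minima. The
point 0 is never lost and does not count. *)
Definition inversions N (v : {set 'S_N.+1}) : {set 'I_N.+1 * 'I_N.+1} :=
  [set x : 'I_N.+1 * 'I_N.+1 | 0 < x.1 < x.2
    & [exists p in v, (x.1 \in mins p) && (x.2 \notin mins p)]].

Lemma inversionsP N (r : nat -> 'S_N.+1) (a b : 'I_N.+1) :
  reflect [/\ 0 < a, a < b &
              exists k, [/\ k <= N, a \in mins (r k) & b \notin mins (r k)]]
          ((a, b) \in inversions (chain_set r)).
Proof.
rewrite inE /=; apply: (iffP andP).
  case=> /andP[a0 ab] /exists_inP[_ /chain_setP[k lek ->] /andP[ak bk]].
  by split=> //; exists k.
case=> a0 ab [k [lek ak bk]]; rewrite a0; split=> //.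
by apply/exists_inP; exists (r k); rewrite ?ak //; apply/chain_setP; exists k.
Qed.

Definition agree_off N (r r' : nat -> 'S_N.+1) k : Prop :=
  forall j, j <= N -> j != k -> r j = r' j.

(** A witness at the rank where the sequences differ can be moved to one of
its two neighbours, unless both points are lost between these neighbours. *)
Lemma inversions_agree N (r r' : nat -> 'S_N.+1) k (a b : 'I_N.+1) :
  saturated r -> saturated r' -> k.+1 < N -> agree_off r r' k.+1 ->
  mins (r k.+2) = mins (r k) :\ a :\ b -> a < b ->
  inversions (chain_set r') \subset (a, b) |: inversions (chain_set r).
Proof.
move=> sr sr' ltk ag e ab; apply/subsetP => -[c d].
case/inversionsP => c0 cd [j [lej cj dj]]; rewrite in_setU1.
have Ir i : i <= N -> c \in mins (r i) -> d \notin mins (r i) ->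
    (c, d) \in inversions (chain_set r).
  by move=> lei ci di; apply/inversionsP; split=> //; exists i.
have [jk|jk] := eqVneq j k.+1; last first.
  by rewrite (Ir j) ?orbT // ag.
rewrite {j}jk in lej cj dj.
have ck : c \in mins (r k).
  rewrite ag ?(ltnW (ltnW ltk)) ?neq_ltn ?leqnn //.
  by rewrite (@sat_mins_sub _ _ k k.+1) // leqnSn.
have dk : d \notin mins (r k.+2).
  rewrite ag // ?neq_ltn ?leqnn ?orbT //; apply: contra dj.
  by apply: (@sat_mins_sub _ _ k.+1 k.+2); rewrite ?leqnSn.
have [dk'|] := boolP (d \in mins (r k)); last first.
  by move=> dk'; rewrite (Ir k) ?orbT // ltnW // ltnW.
have [ck'|ck'] := boolP (c \in mins (r k.+2)); first by rewrite (Ir k.+2) ?orbT.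
have ca : (c == b) || (c == a).
  by move: ck'; rewrite e !in_setD1 ck andbT negb_and !negbK.
have da : (d == b) || (d == a).
  by move: dk; rewrite e !in_setD1 dk' andbT negb_and !negbK.
by case/orP: ca cd => /eqP ->; case/orP: da => /eqP ->;
  rewrite ?ltnn ?eqxx // ltnNge ltnW.
Qed.

Lemma inversions_descent N (r : nat -> 'S_N.+1) k : saturated r -> k.+1 < N ->
  label r k.+1 < label r k -> (label r k.+1, label r k) \in inversions (chain_set r).
Proof.
move=> sr ltk lt; apply/inversionsP; split; rewrite ?label_gt0 //.
by exists k.+1; rewrite label_in ?label_notin ?leqnn // ltnW.
Qed.

Lemma inversions_ascent N (r : nat -> 'S_N.+1) k : saturated r -> k.+1 < N ->
  (label r k, label r k.+1) \notin inversions (chain_set r).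
Proof.
move=> sr ltk; apply/negP => /inversionsP[_ _ [j [lej aj bj]]].
have [lejk|ltkj] := leqP j k.+1; first by rewrite label_in ?lejk in bj.
by move: aj; apply/negP; rewrite label_notin // (ltn_trans _ ltkj).
Qed.

(** The two sequences lose the same two points between ranks k and k + 2, in
an order that the set of minima at rank k + 1 determines. *)
Lemma label_swap N (r r' : nat -> 'S_N.+1) k : saturated r -> saturated r' ->
  k.+1 < N -> agree_off r r' k.+1 -> mins (r k.+1) != mins (r' k.+1) ->
  label r' k = label r k.+1 /\ label r' k.+1 = label r k.
Proof.
move=> sr sr' ltk ag ne; have ltk' := ltnW ltk.
have e0 : r k = r' k by apply: ag; rewrite ?neq_ltn ?leqnn // ltnW.
have e2 : r k.+2 = r' k.+2 by apply: ag; rewrite ?neq_ltn ?leqnn ?orbT.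
have [a1 m1] := label_spec sr ltk'; have [b1 m1'] := label_spec sr' ltk'.
have [a2 m2] := label_spec sr ltk; have [b2 m2'] := label_spec sr' ltk.
have ne1 : label r k != label r' k by apply: contraNneq ne => e; rewrite m1 m1' e0 e.
have/setP key : mins (r k) :\ label r k :\ label r k.+1 =
    mins (r k) :\ label r' k :\ label r' k.+1.
  by rewrite -m1 -m2 e0 -m1' -m2' e2.
have A := key (label r' k); have B := key (label r k).
rewrite !in_setD1 eqxx /= e0 b1 !andbT andbF [label r' k == label r k]eq_sym ne1 andbT in A.
rewrite !in_setD1 eqxx /= a1 !andbT andbF ne1 andbT in B.
by split; [move/negbFE/eqP: A | move/esym/negbFE/eqP: B].
Qed.

Lemma card_inversions_swap N (r r' : nat -> 'S_N.+1) k : saturated r -> saturated r' ->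
  k.+1 < N -> agree_off r r' k.+1 -> mins (r k.+1) != mins (r' k.+1) ->
  label r k < label r k.+1 ->
  #|inversions (chain_set r')| = (#|inversions (chain_set r)|).+1.
Proof.
move=> sr sr' ltk ag ne lt; have [e1 e2] := label_swap sr sr' ltk ag ne.
have ag' : agree_off r' r k.+1 by move=> j lej nj; rewrite ag.
have m2 : mins (r k.+2) = mins (r k) :\ label r k :\ label r k.+1.
  by rewrite (label_spec sr ltk).2 (label_spec sr (ltnW ltk)).2.
have m2' : mins (r' k.+2) = mins (r' k) :\ label r k :\ label r k.+1.
  by rewrite -!ag // ?neq_ltn ?leqnn ?orbT // ltnW // ltnW.
have x' : (label r k, label r k.+1) \in inversions (chain_set r').
  by rewrite -e1 -e2 inversions_descent // e1 e2.
have -> : inversions (chain_set r') = (label r k, label r k.+1) |: inversions (chain_set r).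
  apply/eqP; rewrite eqEsubset (inversions_agree sr sr' ltk ag m2 lt) subUset sub1set x' /=.
  by have := inversions_agree sr' sr ltk ag' m2' lt; rewrite (setUidPr _) ?sub1set.
by rewrite cardsU1 inversions_ascent.
Qed.

Definition swap N (r : nat -> 'S_N.+1) k q : nat -> 'S_N.+1 :=
  fun j => if j == k then q else r j.

Lemma swap_sat N (r : nat -> 'S_N.+1) k q : saturated r -> k.+1 < N ->
  covers (r k) q -> covers q (r k.+2) -> saturated (swap r k.+1 q).
Proof.
move=> [cr rN] ltk c1 c2; rewrite /saturated /swap; split; last first.
  by rewrite gtn_eqF.
move=> j ltj; rewrite eqSS; have [->|jk] := eqVneq j k.
  by rewrite ltn_eqF.
by have [-> //|jk'] := eqVneq j k.+1; apply: cr.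
Qed.

Lemma agree_adj N (r r' : nat -> 'S_N.+1) k : saturated r -> saturated r' ->
  k <= N -> agree_off r r' k -> r k != r' k -> hurwitz_adj (chain_set r) (chain_set r').
Proof.
move=> sr sr' lek ag ne.
have D (s s' : nat -> 'S_N.+1) : saturated s -> saturated s' -> agree_off s s' k ->
    s k != s' k -> chain_set s :\: chain_set s' = [set s k].
  move=> ss ss' ags nes; apply/setP => p; rewrite in_setD in_set1; apply/andP/eqP.
    case=> np /chain_setP[j lej pE]; have [<- //|jk] := eqVneq j k.
    by case/negP: np; apply/chain_setP; exists j; rewrite // pE ags.
  move=> ->; split; last by apply/chain_setP; exists k.
  apply/negP => /chain_setP[j lej e]; case/negP: nes.
  by have := sat_ellT ss lek; rewrite e (sat_ellT ss' lej) => ->.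
rewrite /hurwitz_adj !sat_max // (D r r') // (D r' r) ?cards1 // 1?eq_sym //.
by move=> j lej nj; rewrite ag.
Qed.

(** The element of u that is missing from v has a rank strictly between 0 and
N, since all maximal chains share the identity and the long cycle. *)
Lemma adj_agree N (u v : {set 'S_N.+1}) : hurwitz_adj u v ->
  exists r r' k, [/\ saturated r /\ saturated r', u = chain_set r, v = chain_set r',
    k.+1 < N & agree_off r r' k.+1].
Proof.
case/and4P => /max_chainP[r sr ->] /max_chainP[r' sr' ->] /cards1P[p pE] _.
have /setDP[/chain_setP[i lei pi] pr'] : p \in chain_set r :\: chain_set r'.
  by rewrite pE set11.
have ag : agree_off r r' i.
  move=> j lej nj; have [/chain_setP[l lel e]|nr'] := boolP (r j \in chain_set r').
    by have := sat_ellT sr lej; rewrite e (sat_ellT sr' lel) => ->.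
  have : r j \in chain_set r :\: chain_set r'.
    by rewrite in_setD nr'; apply/chain_setP; exists j.
  rewrite pE in_set1 pi => /eqP e; move: nj.
  by rewrite -(sat_ellT sr lej) e (sat_ellT sr lei) eqxx.
have i0 : i != 0.
  apply: contraNneq pr' => i0; apply/chain_setP; exists 0 => //.
  by rewrite pi i0 !sat0.
have iN : i != N.
  apply: contraNneq pr' => iN; apply/chain_setP; exists N => //.
  by rewrite pi iN sr.2 sr'.2.
case: i i0 => // k _ in lei ag iN pi *; exists r, r', k; split=> //.
by rewrite ltn_neqAle iN lei.
Qed.

Lemma inversions_adj N (u v : {set 'S_N.+1}) :
  hurwitz_adj u v -> #|inversions v| <= (#|inversions u|).+1.
Proof.
case/adj_agree => r [r' [k [[sr sr'] -> -> ltk ag]]].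
have m2 : mins (r k.+2) = mins (r k) :\ label r k :\ label r k.+1.
  by rewrite (label_spec sr ltk).2 (label_spec sr (ltnW ltk)).2.
have [lt|lt|e] := ltngtP (label r k) (label r k.+1).
- have /subset_leq_card := inversions_agree sr sr' ltk ag m2 lt.
  by move/leq_trans; apply; rewrite cardsU1; lia.
- rewrite setDDl setUC -setDDl in m2.
  have /subset_leq_card := inversions_agree sr sr' ltk ag m2 lt.
  by move/leq_trans; apply; rewrite cardsU1; lia.
by case: (label_neq sr ltk).
Qed.

(** Replacing the element between two consecutive labels by the one from
[exchange] gives a neighbour in which these labels trade places. *)
Lemma adjacent_swap N (r : nat -> 'S_N.+1) k : saturated r -> k.+1 < N ->
  exists v, [/\ hurwitz_adj (chain_set r) v, hurwitz_adj v (chain_set r),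
    label r k < label r k.+1 -> #|inversions v| = (#|inversions (chain_set r)|).+1 &
    label r k.+1 < label r k -> #|inversions (chain_set r)| = (#|inversions v|).+1].
Proof.
move=> sr ltk.
have ncr : noncrossing (r k.+2) by apply: sat_nc.
have [q [c1 c2 ne]] := exchange ncr (sr.1 k (ltnW ltk)) (sr.1 k.+1 ltk).
have sr' := swap_sat sr ltk c1 c2; set r' := swap r k.+1 q in sr'.
have ag : agree_off r r' k.+1 by move=> j _ nj; rewrite /r' /swap (negPf nj).
have ag' : agree_off r' r k.+1 by move=> j lej nj; rewrite ag.
have ne' : mins (r k.+1) != mins (r' k.+1) by rewrite /r' /swap eqxx eq_sym.
have ne'' : r k.+1 != r' k.+1 by apply: contraNneq ne' => ->.
have [e1 e2] := label_swap sr sr' ltk ag ne'.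
exists (chain_set r'); split.
- exact: agree_adj (ltnW ltk) ag ne''.
- by apply: agree_adj (ltnW ltk) ag' _; rewrite // eq_sym.
- exact: card_inversions_swap ag ne'.
by move=> lt; apply: card_inversions_swap ag' _ _; rewrite // 1?eq_sym // e1 e2.
Qed.

(** * Distances and maximal elements *)

Lemma increasing_id N (f : nat -> nat) : (forall k, k < N -> 0 < f k <= N) ->
  (forall k, k.+1 < N -> f k < f k.+1) -> forall k, k < N -> f k = k.+1.
Proof.
move=> fN fS k ltk; apply/eqP; rewrite eqn_leq; apply/andP; split; last first.
  elim: k ltk => [|k IHk] ltk; first by have := fN _ ltk; lia.
  by have := IHk (ltnW ltk); have := fS _ ltk; lia.
have [m] := ubnP (N - k); elim: m k ltk => // m IHm k ltk lem.
have := fN _ ltk; have [ltk'|] := ltnP k.+1 N; last lia.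
by have := IHm k.+1 ltk'; have := fS _ ltk'; lia.
Qed.

Lemma label_bounds N (r : nat -> 'S_N.+1) k : saturated r -> k < N ->
  0 < label r k <= N.
Proof. by move=> sr ltk; rewrite label_gt0 //= -ltnS ltn_ord. Qed.

(** The form that decreasing labels take for the sets of minima. *)
Definition falling N (r : nat -> 'S_N.+1) : Prop :=
  forall k, k <= N -> mins (r k) = [set i : 'I_N.+1 | i <= N - k].

Lemma falling_label N (r : nat -> 'S_N.+1) : saturated r ->
  (forall k, k.+1 < N -> label r k.+1 < label r k) -> falling r.
Proof.
move=> sr lt.
have labE k : k < N -> label r k = N - k :> nat.
  move=> ltk; have bd j := @label_bounds _ r j sr.
  suffices : N.+1 - label r k = k.+1 by have := bd k ltk; lia.
  apply: (@increasing_id N (fun k => N.+1 - label r k)) => // j ltj.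
    by have := bd j ltj; lia.
  by have := bd _ ltj; have := bd _ (ltnW ltj); have := lt j ltj; lia.
elim=> [|k IHk] lek.
  apply/setP => i; rewrite sat0 // !inE subn0 -ltnS ltn_ord.
  by have/porbitP[j ->] := cmin_in (1 : 'S_N.+1)%g i; rewrite expg1n perm1 eqxx.
rewrite (label_spec sr lek).2 IHk 1?ltnW //; apply/setP => i.
by rewrite !inE -(inj_eq val_inj) /= labE //; lia.
Qed.

(** In a chain with decreasing labels, all pairs of nonzero points are
inversions. *)
Lemma falling_inversions N (r : nat -> 'S_N.+1) (u : {set 'S_N.+1}) :
  falling r -> inversions u \subset inversions (chain_set r).
Proof.
move=> fr; apply/subsetP => -[c d]; rewrite inE /= => /andP[/andP[c0 cd] _].
have ltc : c <= N by rewrite -ltnS ltn_ord.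
apply/inversionsP; split=> //; exists (N - c); rewrite leq_subr !fr ?leq_subr // !inE.
by rewrite subKn // leqnn -ltnNge.
Qed.

Definition base_word n : seq 'S_n :=
  [seq tperm i (ordS i) | i : 'I_n <- enum 'I_n & i.+1 < n].

Definition base_elt N (k : nat) : 'S_N.+1 := prodp (take k (base_word N.+1)).

Lemma filter_enum_ord N :
  [seq i : 'I_N.+1 <- enum 'I_N.+1 | i.+1 < N.+1] =
  [seq widen_ord (leqnSn N) i | i <- enum 'I_N].
Proof.
rewrite enum_ordSr filter_rcons /= ltnn; apply/all_filterP.
by apply/allP => _ /mapP[i _ ->] /=; rewrite ltnS.
Qed.

Lemma size_base_word N : size (base_word N.+1) = N.
Proof. by rewrite size_map filter_enum_ord size_map size_enum_ord. Qed.

Lemma base_eltS N k (ltk : k < N) :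
  base_elt N k.+1 = tmul (base_elt N k) (inord k) (inord k.+1).
Proof.
rewrite /base_elt (take_nth 1%g) ?size_base_word // prodp_rcons /tmul; congr compp.
rewrite /base_word filter_enum_ord -map_comp (nth_map (Ordinal ltk)) ?size_enum_ord //.
rewrite /comp; have -> : widen_ord (leqnSn N) (nth (Ordinal ltk) (enum 'I_N) k) = inord k.
  by apply: ord_inj; rewrite /= nth_enum_ord // inordK // ltnW.
congr tperm; apply: ord_inj; rewrite val_ordS !inordK ?ltnS ?(ltnW ltk) // eqSS.
by rewrite ltn_eqF.
Qed.

(** The partial products of e are the cycles (0, 1, ..., k). *)
Lemma base_eltE N k (x : 'I_N.+1) : k <= N ->
  base_elt N k x = (if x < k then x.+1 else if x == k :> nat then 0 else x) :> nat.
Proof.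
elim: k x => [|k IHk] x lek.
  by rewrite /base_elt take0 perm1 /=; case: (x : nat).
have k0 : (inord k : 'I_N.+1) = k :> nat by rewrite inordK // ltnS ltnW.
have k1 : (inord k.+1 : 'I_N.+1) = k.+1 :> nat by rewrite inordK.
have lek' := ltnW lek.
rewrite base_eltS //; have [->|x0] := eqVneq x (inord k).
  by rewrite tmulL IHk // k0 k1; repeat case: ifP; lia.
have [->|x1] := eqVneq x (inord k.+1).
  by rewrite tmulR IHk // k0 k1; repeat case: ifP; lia.
rewrite tmulD // IHk //; move: x0 x1; rewrite -!(inj_eq val_inj) /= k0 k1.
by move=> x0 x1; repeat case: ifP; lia.
Qed.

Lemma base_cmin N k (i : 'I_N.+1) : k <= N ->
  cmin (base_elt N k) i = if i <= k then ord0 else i.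
Proof.
move=> lek; case: leqP => [lei|lti]; last first.
  have /porbitP[j ->] := cmin_in (base_elt N k) i.
  elim: j => [|j IHj]; first by rewrite perm1.
  rewrite expgSr permM IHj; apply: ord_inj.
  by rewrite base_eltE // ltnNge ltnW //= gtn_eqF.
case: i lei => i lti; elim: i lti => [|i IHi] lti lei.
  by apply/eqP; rewrite -val_eqE /= -leqn0 (cmin_le _ (Ordinal lti)).
rewrite -(IHi (ltnW lti) (ltnW lei)) -[RHS]cmin_perm; congr cmin; apply: ord_inj.
by rewrite base_eltE //= lei.
Qed.

Lemma base_sat N : saturated (base_elt N).
Proof.
split=> [k ltk|]; last first.
  apply/permP => x; apply: ord_inj; rewrite base_eltE // long_cycleE val_ordS eqSS.
  by have := ltn_ord x; repeat case: ifP; lia.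
exists (inord k.+1), (inord k); rewrite tmulC base_eltS //; split=> //.
by rewrite !base_cmin ?(ltnW ltk) // !inordK ?ltnS ?(ltnW ltk) // leqnn ltnn inordK.
Qed.

Lemma base_chainE N : base_chain N.+1 = chain_set (base_elt N).
Proof.
rewrite /base_chain /chain_of_word -/(base_word N.+1) size_base_word.
exact: eq_imset.
Qed.

Lemma base_inversions N : inversions (base_chain N.+1) = set0.
Proof.
apply/setP => -[c d]; rewrite in_set0 base_chainE; apply/negP.
case/inversionsP => c0 cd [k [lek]]; rewrite !inE !base_cmin //.
case: (leqP d k) => [ledk|]; last by rewrite eqxx.
by rewrite (leq_trans (ltnW cd) ledk) => /eqP cE; rewrite -cE in c0.
Qed.

(** By induction on the rank: the merge with label k + 1 attaches the fixed
point k + 1 to the cycle (0, ..., k), and if it did so at a point y < k,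
the arc from y to k + 1 would separate k from its image 0. *)
Lemma base_unique N (r : nat -> 'S_N.+1) : saturated r ->
  (forall k, k.+1 < N -> label r k < label r k.+1) -> chain_set r = base_chain N.+1.
Proof.
move=> sr lt; rewrite base_chainE; apply/(chain_set_eq sr (base_sat N)).
have labE k : k < N -> label r k = inord k.+1.
  move=> ltk; apply: ord_inj; rewrite inordK //.
  by apply: (@increasing_id N (fun k => label r k)) => // j; apply: label_bounds.
elim=> [|k IHk] lek; first by rewrite !sat0 //; apply: base_sat.
have lek' := ltnW lek; have {}IHk := IHk lek'.
have k0 : (inord k : 'I_N.+1) = k :> nat by rewrite inordK // ltnS.
have k1 : (inord k.+1 : 'I_N.+1) = k.+1 :> nat by rewrite inordK.
have [x [y [ltyx rE]]] := sr.1 k lek; have lb := (label_spec sr lek).2.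
have mx : cmin (r k) x = inord k.+1.
  rewrite -labE //; apply/eqP; apply: contraT => nx.
  have : cmin (r k) x \notin mins (r k.+1) by rewrite rE mins_merge // !inE eqxx.
  by rewrite lb in_setD1 nx cmin_mins.
have fix1 : r k (inord k.+1) = inord k.+1.
  apply: ord_inj; rewrite IHk base_eltE // k1; repeat case: ifP; lia.
have xE : x = inord k.+1.
  have := @merge_at _ (r k) x y (sat_nc sr lek') _ ltyx; rewrite mx -rE => ->.
    by rewrite -{1}fix1 permK.
  exact: sat_nc.
have ley : y <= k.
  by move: ltyx; rewrite mx k1 IHk base_cmin //; case: (leqP y k) => //; lia.
suffices yE : y = inord k by rewrite rE xE yE tmulC IHk base_eltS.
apply: ord_inj; rewrite k0; apply/eqP; rewrite eqn_leq ley leqNgt; apply/negP => ltyk.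
have ncq : noncrossing (r k.+1) by apply: sat_nc.
have := ncq y (inord k).
have -> : r k.+1 y = inord k.+1 by rewrite rE tmulR xE fix1.
have -> : r k.+1 (inord k) = ord0.
  rewrite rE tmulD; first by apply: ord_inj; rewrite IHk base_eltE // k0 ltnn eqxx.
    by rewrite xE -val_eqE /= k0 k1; lia.
  by rewrite -val_eqE /= k0; lia.
by rewrite /between k0 k1 /=; lia.
Qed.

Lemma path_inversions N (u : {set 'S_N.+1}) p : path (@hurwitz_adj N.+1) u p ->
  #|inversions (last u p)| <= #|inversions u| + size p.
Proof.
elim: p u => [|v p IHp] u /=; first by rewrite addn0.
case/andP => /inversions_adj uv /IHp le; apply: leq_trans le _.
by rewrite addnS -addSn leq_add2r.
Qed.

Lemma label_cases N (r : nat -> 'S_N.+1) (P : rel nat) :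
  (forall k, k.+1 < N -> P (label r k) (label r k.+1)) \/
  exists2 k, k.+1 < N & ~~ P (label r k) (label r k.+1).
Proof.
have [[k ltk nP]|no] := pselect (exists2 k, k.+1 < N & ~~ P (label r k) (label r k.+1)).
  by right; exists k.
by left => k ltk; apply: contraT => nP; case: no; exists k.
Qed.

(** Remove descents one at a time; each removal lowers the number of
inversions by one. *)
Lemma path_from_base N (v : {set 'S_N.+1}) : v \in max_chains N.+1 ->
  exists p, [/\ path (@hurwitz_adj N.+1) (base_chain N.+1) p,
    last (base_chain N.+1) p = v & size p = #|inversions v|].
Proof.
move dE: #|inversions v| => d; elim: d v dE => [|d IHd] v dE vm;
    have [r sr vE] := max_chainP vm; rewrite {}vE in dE *;
    have [lt|[k ltk ge]] := label_cases r ltn.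
- by exists [::]; rewrite (base_unique sr lt).
- have desc : label r k.+1 < label r k by have := label_neq sr ltk; lia.
  by have [v' [_ _ _ /(_ desc)]] := adjacent_swap sr ltk; rewrite dE.
- by rewrite (base_unique sr lt) base_inversions cards0 in dE.
have desc : label r k.+1 < label r k by have := label_neq sr ltk; lia.
have [v' [_ v'v _ /(_ desc) e]] := adjacent_swap sr ltk.
have v'm : v' \in max_chains N.+1 by case/and4P: v'v.
have [|p [pp pl ps]] := IHd v' _ v'm; first lia.
exists (rcons p (chain_set r)); split; last by rewrite size_rcons ps.
  by rewrite rcons_path pp pl.
by rewrite last_rcons.
Qed.

Lemma geodesic_size N (v : {set 'S_N.+1}) p : v \in max_chains N.+1 ->
  geodesic (@hurwitz_adj N.+1) (base_chain N.+1) v p -> size p = #|inversions v|.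
Proof.
move=> vm [pp pl pmin]; have [q [qq ql qs]] := path_from_base vm.
apply/eqP; rewrite eqn_leq -{1}qs pmin //=.
by have := path_inversions pp; rewrite pl base_inversions cards0 add0n.
Qed.

(** At an ascent, a geodesic can be prolonged. A chain with decreasing labels
is as far from e as any other, so a geodesic through it must end there. *)
Lemma weak_maximalP N (v : {set 'S_N.+1}) :
  weak_maximal v <-> exists r, [/\ saturated r, v = chain_set r & falling r].
Proof.
split=> [[vm vmax]|[r [sr -> fr]]].
  have [r sr vE] := max_chainP vm; exists r; split=> //; apply: falling_label => //.
  have [//|[k ltk ge]] := label_cases r (fun i j => j < i); exfalso.
  have asc : label r k < label r k.+1 by have := label_neq sr ltk; lia.
  have [w [vw wv /(_ asc) e _]] := adjacent_swap sr ltk.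
  have wm : w \in max_chains N.+1 by case/and4P: vw.
  have [p [pp pl ps]] := path_from_base vm; rewrite -vE in vw wv e.
  suffices wv' : w = v by rewrite wv' in e; lia.
  apply: vmax => //; exists (rcons p w); split; last first.
    by rewrite -pl -cats1 -cat_cons mem_cat mem_last.
  split; rewrite ?last_rcons // ?rcons_path ?pp ?pl // => q qq ql.
  rewrite size_rcons ps -e; have := path_inversions qq.
  by rewrite ql base_inversions cards0.
split=> [|w wm [p [pg /splitPl sp]]]; first exact: sat_max.
have ps := geodesic_size wm pg; case: pg sp => pp pl _ sp.
case: sp pp pl ps => p1 p2 p1l; rewrite cat_path last_cat size_cat p1l.
move=> /andP[pp1 _] wE ps.
have := path_inversions pp1; rewrite p1l base_inversions cards0 add0n => le1.
have := subset_leq_card (falling_inversions w fr) => le2.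
case: p2 wE ps => //= x p2 _ ps.
have : size p1 + (size p2).+1 <= size p1 by rewrite ps; apply: leq_trans le2 le1.
by rewrite addnS ltnNge leq_addr.
Qed.

(** * Chains with decreasing labels *)

(** The intervals [j, y j] for 1 <= j <= N are pairwise nested or disjoint. *)
Definition laminar N (y : nat -> nat) : Prop := forall j, 0 < j <= N ->
  j <= y j <= N /\ forall i, 0 < i < j -> j <= y i -> y j <= y i.

(** From the long cycle downwards, step m cuts off the cycle with minimum m
that ends at y m. It is cut at the predecessor of m, which becomes the
predecessor of what follows y m. *)
Fixpoint cut N (y : nat -> nat) m : 'S_N.+1 :=
  if m is k.+1 then
    let p := cut N y k in tmul p (p^-1%g (inord m)) (inord (y m))
  else long_cycle N.+1.

(** The largest i <= m with i <= z <= y i, or 0: the minimum of the cycle of z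
after m cuts. *)
Fixpoint owner (y : nat -> nat) m (z : nat) : nat :=
  if m is k.+1 then if k < z <= y m then m else owner y k z else 0.

Lemma owner_le y m z : owner y m z <= m.
Proof. by elim: m => //= m IHm; case: ifP => // _; apply: leqW. Qed.

Lemma owner_id N y m z : laminar N y -> m <= N -> z <= m -> owner y m z = z.
Proof.
move=> ly; elim: m => [|m IHm] /= lem lez; first by rewrite leqn0 in lez; apply/esym/eqP.
have [ltz|lez'] := ltnP m z; last by rewrite IHm // ltnW.
have -> : z = m.+1 by apply/eqP; rewrite eqn_leq lez.
by have [/andP[-> _] _] := ly m.+1 lem.
Qed.

(** By laminarity, an interval that starts at or before m and contains m + 1
contains all of [m+1, y (m+1)]. *)
Lemma owner_block N y m z : laminar N y -> m < N -> m < z <= y m.+1 ->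
  owner y m z = owner y m m.+1.
Proof.
move=> ly ltm /andP[ltz lez].
elim: {1 3 4}m (leqnn m) => [|k IHk] lekm //=.
have [_ lk] := ly m.+1 ltm; have := lk k.+1 lekm.
by rewrite IHk ?(ltnW lekm) // => lk'; congr (if _ then _ else _); apply/idP/idP; lia.
Qed.

(** The predecessor x of m + 1 is the minimum of its cycle, as the points
below m + 1 lie in different cycles. By laminarity, y (m+1) lies in the
same cycle, so the cut splits it; the new cycle of y (m+1) consists of the
points of [m+1, y (m+1)], because its arc back to m + 1 separates no
cycle. *)
Lemma cut_step N y m : laminar N y -> m < N -> noncrossing (cut N y m) ->
  (forall z, cmin (cut N y m) z = owner y m z :> nat) ->
  [/\ noncrossing (cut N y m.+1),
      forall z, cmin (cut N y m.+1) z = owner y m.+1 z :> nat,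
      covers (cut N y m.+1) (cut N y m)
    & cut N y m.+1 (inord (y m.+1)) = inord m.+1].
Proof.
move=> ly ltm; rewrite [cut N y m.+1]/=; set p := cut N y m => ncp pE.
set w : 'I_N.+1 := inord m.+1; set x := p^-1%g w; set e : 'I_N.+1 := inord (y m.+1).
have [/andP[lemy leyN] _] := ly m.+1 ltm.
have wE : w = m.+1 :> nat by rewrite inordK.
have eE : e = y m.+1 :> nat by rewrite inordK.
have pxw : p x = w by rewrite permKV.
have pxm : cmin p x = cmin p w by rewrite -pxw cmin_perm.
have lexm : x <= m.
  rewrite leqNgt; apply/negP => ltmx.
  have := nc_back ncp (_ : p x <= x); rewrite pxw wE => /(_ ltmx) e1.
  by have := owner_le y m x; rewrite -pE -e1 wE ltnn.
have mux : cmin p x = x by apply: ord_inj; rewrite pE (owner_id ly (ltnW ltm)).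
have mue : cmin p e = x.
  apply: ord_inj; rewrite pE eE (owner_block ly ltm) ?lemy ?leqnn //.
  by rewrite -wE -pE -pxm mux.
have nxe : x != e by rewrite -val_eqE /= eE; lia.
have exe : cmin p x = cmin p e by rewrite mux mue.
have ncq := nc_split ncp nxe exe; have nq := cmin_split_joint nxe exe.
have qe : tmul p x e e = w by rewrite tmulR.
set q := tmul p x e in ncq nq qe *.
have qle : q e <= e by rewrite qe wE eE.
have mqe : cmin q e = w by rewrite -(nc_back ncq qle).
have ltq : cmin q x < cmin q e by rewrite mqe wE ltnS (leq_trans (cmin_le q x)).
have pq : p = tmul q e x by rewrite tmulC /q tmulK.
have muq u : cmin p u = if cmin q u == cmin q e then cmin q x else cmin q u.
  by rewrite {1}pq cmin_merge.
have mqx : cmin q x = x by have := muq x; rewrite (negPf nq) mux.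
split=> //; last by exists e, x.
move=> u /=; have [eu|nu] := eqVneq (cmin q u) (cmin q e).
  have := nc_span ncq qle eu; rewrite qe wE eE => -> .
  by rewrite eu mqe.
have cmin_u : cmin p u = cmin q u by rewrite muq (negPf nu).
case: ifP => [/andP[ltu leu]|_]; last by rewrite -cmin_u pE.
have ux : cmin q u = cmin q x.
  rewrite -cmin_u mqx; apply: ord_inj; rewrite pE (owner_block ly ltm) ?ltu //.
  by rewrite -wE -pE -pxm mux.
have := nc_same e ncq ux; rewrite qe /between wE eE.
by move: lexm ltu leu lemy; clear; lia.
Qed.

Lemma cut_spec N y m : laminar N y -> m <= N -> noncrossing (cut N y m) /\
  forall z, cmin (cut N y m) z = owner y m z :> nat.
Proof.
move=> ly; elim: m => [|m IHm] lem.
  by split=> [|z]; [apply: nc_long_cycle | rewrite cmin_long_cycle].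
have [ncp pE] := IHm (ltnW lem).
by have [] := cut_step ly lem ncp pE.
Qed.

(** Rank k is reached after N - k cuts. *)
Definition cut_chain N (y : nat -> nat) : nat -> 'S_N.+1 := fun k => cut N y (N - k).

Lemma cut_chain_sat N y : laminar N y -> saturated (@cut_chain N y).
Proof.
move=> ly; split=> [k ltk|]; last by rewrite /cut_chain subnn.
rewrite /cut_chain -(subnSK ltk).
have ltk' : N - k.+1 < N by lia.
have [ncp pE] := cut_spec ly (ltnW ltk').
by have [] := cut_step ly ltk' ncp pE.
Qed.

Lemma cut_chain_falling N y : laminar N y -> falling (@cut_chain N y).
Proof.
move=> ly k lek; have lek' : N - k <= N by rewrite leq_subr.
have [_ pE] := cut_spec ly lek'.
apply/setP => i; rewrite !inE -val_eqE /= pE; have [lei|lti] := leqP i (N - k).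
  by rewrite (owner_id ly lek' lei) eqxx.
by rewrite ltn_eqF // (leq_ltn_trans _ lti) // owner_le.
Qed.

Lemma cut_inj N y y' : laminar N y -> laminar N y' ->
  chain_set (@cut_chain N y) = chain_set (@cut_chain N y') ->
  forall j, 0 < j <= N -> y j = y' j.
Proof.
move=> ly ly' /(chain_set_eq (cut_chain_sat ly) (cut_chain_sat ly')) e.
case=> // j /= ltj; have ce k : k <= N -> cut N y k = cut N y' k.
  by move=> lek; have := e (N - k) (leq_subr _ _); rewrite /cut_chain subKn.
have at_y z : laminar N z -> cut N z j.+1 (inord (z j.+1)) = inord j.+1.
  move=> lz; have [ncp pE] := cut_spec lz (ltnW ltj).
  by have [] := cut_step lz ltj ncp pE.
have := at_y y ly; rewrite ce // -(at_y y' ly') => /perm_inj/(congr1 val) /=.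
by rewrite !inordK ?ltnS ?(ly _ ltj).1 ?(ly' _ ltj).1 //; have [/andP[]] := ly j.+1 ltj;
  have [/andP[]] := ly' j.+1 ltj.
Qed.

Lemma cut_ext N y y' : (forall j, 0 < j <= N -> y j = y' j) ->
  chain_set (@cut_chain N y) = chain_set (@cut_chain N y').
Proof.
move=> e; have ce m : m <= N -> cut N y m = cut N y' m.
  by elim: m => //= m IHm ltm; rewrite IHm ?(ltnW ltm) // e.
by apply: eq_imset => k; rewrite /cut_chain ce // leq_subr.
Qed.

Lemma covers_coarsen n (p q : 'S_n) u v :
  covers p q -> cmin p u = cmin p v -> cmin q u = cmin q v.
Proof.
case=> x [y [lt ->]] uv; apply: tmul_coarsen uv; apply: cmin_merge_joint.
by apply: contraTneq lt => ->; rewrite ltnn.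
Qed.

(** Let y m be the predecessor of m in the element with minima 0, ..., m, that
is, the largest point of the cycle of m. The interval [m, y m] is a union
of cycles of this element and of all finer ones, so these intervals are
laminar. By [merge_at], the merge with label m + 1 happens at y (m+1),
hence it undoes the cut. *)
Lemma falling_cut N (r : nat -> 'S_N.+1) : saturated r -> falling r ->
  exists2 y, laminar N y & chain_set r = chain_set (@cut_chain N y).
Proof.
move=> sr fr; pose s m := r (N - m).
pose y m : nat := ((s m)^-1%g (inord m) : 'I_N.+1).
have cs m : m < N -> covers (s m.+1) (s m).
  by move=> ltm; rewrite /s -(subnSK ltm); apply: sr.1; lia.
have ms m i : m <= N -> (i \in mins (s m)) = (i <= m).
  by move=> lem; rewrite fr ?leq_subr // inE subKn.
have ncs m : noncrossing (s m) by exact: (sat_nc sr (leq_subr m N)).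
have sy m : m <= N -> exists2 a : 'I_N.+1, a = y m :> nat & s m a = inord m.
  by move=> lem; exists ((s m)^-1%g (inord m)); rewrite ?permKV.
have coarse i j u v :
    i <= j <= N -> cmin (s j) u = cmin (s j) v -> cmin (s i) u = cmin (s i) v.
  elim: j => [|j IHj] /andP[leij lej]; first by move: leij; rewrite leqn0 => /eqP ->.
  move: leij; rewrite leq_eqVlt => /orP[/eqP -> //|ltij] /(covers_coarsen (cs j lej)).
  by apply: IHj; rewrite -ltnS ltij ltnW.
have ge_y j : 0 < j <= N -> j <= y j.
  case/andP => j0 lej; have [a <- sa] := sy j lej.
  have : inord j \in mins (s j) by rewrite ms // inordK.
  by rewrite inE -sa cmin_perm => /eqP e; have := cmin_le (s j) a; rewrite e sa inordK.
have ly : laminar N y.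
  move=> j /andP[j0 lej]; split; first by rewrite ge_y ?j0 // -ltnS ltn_ord.
  move=> i /andP[i0 ltij] leji; have lei : i <= N by rewrite (leq_trans (ltnW ltij)).
  have [a ay sa] := sy i lei; have [b bY sb] := sy j lej.
  have eb : cmin (s i) b = cmin (s i) (inord j).
    by apply: (coarse i j); [rewrite lej (ltnW ltij) | rewrite -sb cmin_perm].
  have := nc_same a (ncs i) eb; rewrite sa /between !inordK // ay bY.
  by have := ge_y i; rewrite i0 lei => /(_ isT); lia.
exists y => //; apply/(chain_set_eq sr (cut_chain_sat ly)) => k lek.
suffices sE m : m <= N -> s m = cut N y m.
  by rewrite /cut_chain -sE ?leq_subr // /s subKn.
elim: m => [|m IHm] ltm; first by rewrite /s subn0 sr.2.
have [a [b [lt sE]]] := cs m ltm.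
have mua : cmin (s m.+1) a = inord m.+1.
  apply/eqP; apply: contraT => ne.
  have : (inord m.+1 : 'I_N.+1) \in mins (s m).
    by rewrite sE mins_merge // in_setD1 eq_sym ne ms // inordK /=.
  by rewrite ms ?(ltnW ltm) // inordK // ltnn.
have aE : a = inord (y m.+1).
  have ncm : noncrossing (tmul (s m.+1) a b) by rewrite -sE.
  by have := merge_at (ncs m.+1) ncm lt; rewrite mua => ->; rewrite inord_val.
have bE : b = (s m)^-1%g (inord m.+1).
  apply: (@perm_inj _ (s m)); rewrite permKV sE tmulR -mua.
  by apply: (merge_at_max _ _ lt) => //; rewrite -sE.
by rewrite /= -IHm ?(ltnW ltm) // -bE -aE tmulC sE tmulK.
Qed.

(** * Ballot numbers *)

(** The number of ways to make m successive choices when the first has s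
options and taking the one that leaves i - 1 others behind it gives i + 1
options for the next. *)
Fixpoint ballot (m s : nat) : nat :=
  if m is k.+1 then \sum_(1 <= i < s.+1) ballot k i.+1 else 1.

Lemma ballotSS m s : ballot m.+1 s.+1 = ballot m.+1 s + ballot m s.+2.
Proof. by rewrite /= big_nat_recr. Qed.

(** As a difference of two binomials, ballot (m+1) s turns the recursion
[ballotSS] into Pascal's rule for each of them. *)
Lemma ballotE m s :
  ballot m.+1 s + 'C(2 * m + s + 1, m) = 'C(2 * m + s + 1, m.+1).
Proof.
elim: m s => [|m IHm] s.
  elim: s => [|s IHs]; first by rewrite /= big_geq.
  by move: IHs; rewrite ballotSS !bin0 !bin1 /=; lia.
elim: s => [|s IHs].
  rewrite /= big_geq // add0n addn0.
  by rewrite -[RHS]bin_sub; [congr binomial; lia | lia].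
rewrite ballotSS; have := IHm s.+2.
have -> : 2 * m.+1 + s.+1 + 1 = (2 * m.+1 + s + 1).+1 by lia.
have -> : 2 * m + s.+2 + 1 = 2 * m.+1 + s + 1 by lia.
by move: IHs; set X := 2 * m.+1 + s + 1; rewrite (binS X m.+1) (binS X m); lia.
Qed.

Lemma ballot1 m : m.+1 * ballot m 1 = 'C(2 * m, m).
Proof.
case: m => [|m]; first by [].
have := ballotE m 1; have -> : 2 * m + 1 + 1 = 2 * m.+1 by lia.
have := mul_bin_left (2 * m.+1) m; have -> : 2 * m.+1 - m = m.+2 by lia.
nia.
Qed.

(** Laminar families are encoded by the lists of the numbers z = N - y_j for j
= 1, ..., N, built from the last entry to the first. These are the values
that may be put in front of L: its own position, and every earlier option
that the head of L does not hide. *)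
Fixpoint slots (L : seq nat) : seq nat :=
  if L is z :: L' then (size L').+1 :: [seq e <- slots L' | e <= z] else [:: 0].

Fixpoint stacked (L : seq nat) : bool :=
  if L is z :: L' then (z \in slots L') && stacked L' else true.

Fixpoint stacks (m : nat) : seq (seq nat) :=
  if m is k.+1 then [seq z :: L | L <- stacks k, z <- slots L] else [:: [::]].

Lemma slotsP L z : reflect
  (z <= size L /\ forall i, i < size L -> z <= size L - i.+1 -> z <= nth 0 L i)
  (z \in slots L).
Proof.
elim: L z => [|a L IHL] z /=.
  by rewrite inE -leqn0; apply: (iffP idP) => [->|[]].
rewrite inE mem_filter; apply: (iffP orP) => [[/eqP ->|/andP[za /IHL[zL zn]]]|[zL zn]].
- by split=> // -[|i] lti /=; lia.
- split=> [|[|i] lti le /=]; rewrite ?leqW //; apply: zn => //.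
move: zL; rewrite leq_eqVlt ltnS => /orP[->|zL]; [by left | right].
apply/andP; split; first by apply: (zn 0); lia.
by apply/IHL; split=> // i lti le; apply: (zn i.+1).
Qed.

Lemma slots_sorted L : sorted gtn (slots L).
Proof.
elim: L => //= z L IHL; rewrite path_min_sorted; last first.
  by apply/allP => e; rewrite mem_filter => /andP[_ /slotsP[]].
by apply: sorted_filter IHL => a b c /= ab bc; apply: ltn_trans ab.
Qed.

Lemma stackedP L : reflect
  (forall i, i < size L -> nth 0 L i <= size L - i.+1 /\
     forall k, i < k < size L -> nth 0 L i <= size L - k.+1 -> nth 0 L i <= nth 0 L k)
  (stacked L).
Proof.
elim: L => [|z L IHL] /=; first by apply: (iffP idP).
apply: (iffP andP) => [[/slotsP[zL zn] /IHL sL]|sL].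
  case=> [|i] lti /=; last first.
    have [le h] := sL i lti; split=> // -[//|k] /= ltk; apply: h.
    by lia.
  by split=> [|[//|k] /= ltk le]; [lia | apply: zn; lia].
split.
  have [le h] := sL 0 isT; apply/slotsP; split=> [|i lti lez].
    by move: le; rewrite /= subn1.
  by apply: (h i.+1).
apply/IHL => i lti; have [le h] := sL i.+1 lti; split=> // k ltk lek.
by apply: (h k.+1).
Qed.

Lemma mem_stacks m L : (L \in stacks m) = (size L == m) && stacked L.
Proof.
elim: m L => [|m IHm] [|z L] //=.
  by apply/negP => /allpairsPdep[? [? []]].
rewrite eqSS; apply/allpairsPdep/and3P => [[L' [z' [L'm zL [-> ->]]]]|[sL zL vL]].
  by move: L'm; rewrite IHm => /andP[].
by exists L, z; rewrite IHm sL.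
Qed.

Lemma uniq_stacks m : uniq (stacks m).
Proof.
elim: m => //= m IHm; apply: allpairs_uniq_dep => // [L _|].
  apply: (sorted_uniq _ _ (slots_sorted L)) => [a b c ab bc|a]; rewrite /= ?ltnn //.
  by apply: ltn_trans ab.
by move=> [L z] [L' z'] _ _ /= [-> ->].
Qed.

(** In a decreasing list, the numbers of entries not exceeding the successive
entries are size s, ..., 1. *)
Lemma sum_slots (g : nat -> nat) (s : seq nat) : sorted gtn s ->
  \sum_(z <- s) g (size [seq e <- s | e <= z]) = \sum_(1 <= i < (size s).+1) g i.
Proof.
elim: s => [|a s IHs] /= as_; first by rewrite big_nil big_geq.
have tr : transitive gtn by move=> x y z xy yz; apply: ltn_trans xy.
have lt_a : all (fun e => e < a) s by move: as_; rewrite (path_sortedE tr) => /andP[].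
have fa : [seq e <- s | e <= a] = s.
  by apply/all_filterP; apply: sub_all lt_a => e; apply: ltnW.
rewrite big_cons big_nat_recr //= leqnn fa addnC -IHs ?(path_sorted as_) //.
congr (_ + _); rewrite !big_seq; apply: eq_bigr => z /(allP lt_a) za.
by rewrite leqNgt za.
Qed.

(** Exchanging one step of enumeration for one step of the recursion keeps the
sum constant. *)
Lemma sum_ballot_stacks k m :
  \sum_(L <- stacks m) ballot k (size (slots L)) = ballot (m + k) 1.
Proof.
elim: m k => [|m IHm] k; first by rewrite big_seq1.
rewrite addSnnS -IHm /= big_allpairs_dep; apply: eq_bigr => L _ /=.
by rewrite (sum_slots (fun i => ballot k i.+1) (slots_sorted L)).
Qed.

Lemma size_stacks m : size (stacks m) = ballot m 1.
Proof. by rewrite -[m in RHS]addn0 -(sum_ballot_stacks 0) sum1_size. Qed.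

(** * The count *)

Definition ends N (L : seq nat) (j : nat) : nat := N - nth 0 L j.-1.

Lemma stacked_laminar N L : size L = N -> stacked L -> laminar N (ends N L).
Proof.
move=> sL /stackedP vL [//|j] /= ltj; rewrite -sL in ltj.
have [le _] := vL j ltj; rewrite /ends /=; split; first by lia.
case=> // i /= lti; have [lei h] := vL i (ltn_trans (lti : i < j) ltj).
move=> leji; have := h j; rewrite (lti : i < j) ltj => /(_ isT).
by lia.
Qed.

Lemma laminar_stacked N y : laminar N y -> exists L,
  [/\ size L = N, stacked L & forall j, 0 < j <= N -> y j = ends N L j].
Proof.
move=> ly; pose L := mkseq (fun i => N - y i.+1) N; exists L; split.
- by rewrite size_mkseq.
- apply/stackedP; rewrite size_mkseq => i lti; rewrite nth_mkseq //.
  have [yi _] := ly i.+1 lti; split; first by lia.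
  move=> k /andP[ltik ltk]; rewrite nth_mkseq //; have [yk h] := ly k.+1 ltk.
  by have := h i.+1 ltik; lia.
case=> // j ltj; rewrite /ends /= nth_mkseq //.
have [/andP[_ le] _] := ly j.+1 ltj.
by rewrite subKn.
Qed.

Lemma stacks_inj N L L' : L \in stacks N -> L' \in stacks N ->
  (forall j, 0 < j <= N -> ends N L j = ends N L' j) -> L = L'.
Proof.
have bound K i : K \in stacks N -> size K = N /\ (i < N -> nth 0 K i <= N).
  rewrite mem_stacks => /andP[/eqP sK /stackedP vK]; split=> // lti.
  by rewrite -sK in lti *; have [le _] := vK i lti; apply: leq_trans le (leq_subr _ _).
move=> LN LN' e; have [[sL _] [sL' _]] := (bound L 0 LN, bound L' 0 LN').
apply: (@eq_from_nth _ 0) => [|i]; rewrite sL // => lti.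
have [_ /(_ lti) le] := bound L i LN; have [_ /(_ lti) le'] := bound L' i LN'.
by have := e i.+1 lti; rewrite /ends /=; lia.
Qed.

Lemma card_weak_maximal N :
  #|[set v : {set 'S_N.+1} | `[< weak_maximal v >]]| = ballot N 1.
Proof.
pose f L := chain_set (@cut_chain N (ends N L)).
rewrite -size_stacks -(size_map f); set vs := map f _.
have lamP L : L \in stacks N -> laminar N (ends N L).
  by rewrite mem_stacks => /andP[/eqP sL vL]; apply: stacked_laminar.
have <- : #|vs| = size vs.
  apply/card_uniqP; rewrite map_inj_in_uniq ?uniq_stacks // => L L' Lm L'm.
  by move/(cut_inj (lamP _ Lm) (lamP _ L'm)); apply: stacks_inj.
apply: eq_card => v; rewrite inE; apply/asboolP/mapP.
  case/weak_maximalP => r [sr -> fr].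
  have [y ly ->] := falling_cut sr fr; have [L [sL vL yE]] := laminar_stacked ly.
  exists L; last exact: cut_ext.
  by rewrite mem_stacks sL eqxx.
case=> L /lamP lL ->; apply/weak_maximalP; exists (@cut_chain N (ends N L)).
by split=> //; [apply: cut_chain_sat | apply: cut_chain_falling].
Qed.

Theorem theorem6p1 (n : nat) (hn : 1 <= n) :
  (#|[set v : {set 'S_n} | `[< weak_maximal v >]]|%:R
   = n%:R^-1 * 'C(2 * n - 2, n - 1)%:R :> rat)%R.
Proof.
case: n hn => // N _; rewrite card_weak_maximal.
have -> : 2 * N.+1 - 2 = 2 * N by lia.
rewrite subn1 /= -ballot1 GRing.natrM GRing.mulKf //.
by rewrite Num.Theory.pnatr_eq0.
Qed.
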